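(* Let $n\ge 1$, let $L$ be an oriented link with $n$ components numbered $L_1,\dots,L_n$, and let $S=(s_{ij})$ and $T=(t_{ij})$ be symmetric $n\times n$ matrices with all entries in $\{-1,0,+1\}$ such that $t_{ij}=0$ if and only if $s_{ij}=0$. Let $D$ and $E$ be diagrams of $L$ in the $2$-sphere such that $E$ is obtained from $D$ by a single Reidemeister move. Then: (1) if the move is an RI move, $iu_{S,T}(E)=iu_{S,T}(D)$; (2) if the move is an RII move, $|iu_{S,T}(E)-iu_{S,T}(D)|\le 1$; (3) if the move is an RIII move, $|iu_{S,T}(E)-iu_{S,T}(D)|\le 2$.
   Context: A knot is regarded as a link with one component. Link diagrams lie in the $2$-sphere; links and diagrams are oriented unless otherwise specified. RI, RII, RIII denote the Reidemeister moves of types I, II, III: an RI (resp. RII) move creates or deletes a monogon (resp. bigon) face, and an RIII move is performed on a $3$-gon face, deleting it and creating a new one. Orientations and the numbering of components are carried along by Reidemeister moves. Smoothings: at a crossing $x$ of an oriented diagram $D$, cut the link at the two preimage points of $x$, and paste the four short subarcs near the resulting endpoints in a way other than the original one. If the pasting connects orientations consistently this is the (regular) smoothing, and $D_x$ denotes the link represented by the resulting diagram. If the pasting connects orientations inconsistently this is the irregular smoothing, and $\check{D_x}$ denotes the unoriented link represented by the resulting diagram. Unknotting number: for an $m$-component link $K$, $u(K)$ is the minimum number of crossing changes in a sequence of Reidemeister moves and crossing changes (crossing changes are allowed at any crossing, between the same or distinct components) deforming a diagram of $K$ into a diagram of the trivial $m$-component link (the link bounding a disjoint union of $m$ disks). Invariant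 $iu_{S,T}$: let $L$ be an oriented link with components $L_1,\dots,L_n$, $S$ and $T$ symmetric $n\times n$ matrices with entries in $\{-1,0,+1\}$ such that $t_{ij}=0$ iff $s_{ij}=0$, and $D$ a diagram of $L$. Let $\mathcal{C}(D)$ (resp. $\check{\mathcal{C}}(D)$) be the set of crossings of $D$ between subarcs of components $L_i$ and $L_j$ (possibly $i=j$) with $s_{ij}=+1$ (resp. $s_{ij}=-1$). For a crossing $x$ between subarcs of $L_i$ and $L_j$ put $t(x)=t_{ij}$, and let $\mathrm{sign}(x)\in\{\pm1\}$ be the usual sign of the crossing. Then $$iu_{S,T}(D)=\sum_{x\in\mathcal{C}(D)}t(x)\,\mathrm{sign}(x)\,|u(D_x)-u(L)|+\sum_{x\in\check{\mathcal{C}}(D)}t(x)\,\mathrm{sign}(x)\,|u(\check{D_x})-u(L)|,$$ with value $0$ for a diagram with no crossings. *)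

(* Defs.v *)
From Stdlib Require Import Relation_Operators.
From mathcomp Require Import all_boot all_order all_algebra.
From mathcomp Require Import boolp classical_sets.

Set Implicit Arguments.
Unset Strict Implicit.
Unset Printing Implicit Defensive.

Import Order.TTheory GRing.Theory Num.Theory.

(* A link diagram is put in general position with respect to a height function
   on the plane (the 2-sphere minus a point) and cut into horizontal slices,
   each containing one event: a local minimum (Cup), a local maximum (Cap) or a
   crossing.  It is recorded as the word of its events, from bottom to top.
   The natural number in an event is the number of strands to its left.

   Every strand carries a decoration in A, as seen when it is traversed
   upwards; opp is the effect on decorations of reversing the direction.
   - A = unit for unoriented diagrams;
   - A = 'I_n * bool for oriented diagrams with numbered components: the
     component, and whether the strand is oriented upwards.

   Cup i a     : new strands i and i+1, decorated with a and opp a;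
   Cap i       : strands i and i+1 are joined and disappear;
   Cross i b   : strands i and i+1 cross; b tells whether the strand going from
                 lower left to upper right is the upper one. *)
Inductive event (A : Type) : Type :=
  | Cup of nat & A
  | Cap of nat
  | Cross of nat & bool.

Arguments Cap {A} _.
Arguments Cross {A} _ _.

Definition word (A : Type) : Type := seq (event A).

Definition pos (A : Type) (e : event A) : nat :=
  match e with Cup i _ => i | Cap i => i | Cross i _ => i end.

(* Events are read from bottom to top: in is below, out is above. *)
Definition arity_in (A : Type) (e : event A) : nat :=
  match e with Cup _ _ => 0 | Cap _ => 2 | Cross _ _ => 2 end.

Definition arity_out (A : Type) (e : event A) : nat :=
  match e with Cup _ _ => 2 | Cap _ => 0 | Cross _ _ => 2 end.

Definition shift (A : Type) (d : nat) (e : event A) : event A :=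
  match e with
  | Cup i a => Cup (d + i) a
  | Cap i => Cap (d + i)
  | Cross i b => Cross (d + i) b
  end.

Definition map_event (A B : Type) (f : A -> B) (e : event A) : event B :=
  match e with
  | Cup i a => Cup i (f a)
  | Cap i => Cap i
  | Cross i b => Cross i b
  end.

(* The decorations of the strands, from left to right, just above an event
   (resp. a word), given those just below it; None if it does not fit. *)
Definition apply_event (A : eqType) (opp : A -> A) (e : event A) (s : seq A) :
    option (seq A) :=
  match e with
  | Cup i a =>
      if (i <= size s)%N then Some (take i s ++ a :: opp a :: drop i s)
      else None
  | Cap i =>
      if drop i s is x :: y :: s' then
        if y == opp x then Some (take i s ++ s') else None
      else None
  | Cross i _ =>
      if drop i s is x :: y :: s' then Some (take i s ++ y :: x :: s')
      else None
  end.

Fixpoint run (A : eqType) (opp : A -> A) (w : word A) (s : seq A) :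
    option (seq A) :=
  if w is e :: w' then obind (run opp w') (apply_event opp e s) else Some s.

Definition is_diagram (A : eqType) (opp : A -> A) (w : word A) : Prop :=
  run opp w [::] = Some [::].

(* Planar isotopy of sliced diagrams is generated by: exchange of the heights
   of two consecutive distant events, creation or cancellation of a maximum
   and a minimum, and passage of an extremum of one strand through a crossing
   (whose two strands then exchange their roles, whence the change of b). *)
Inductive planar_local (A : Type) : word A -> word A -> Prop :=
  | PlanarExchange e f :
      planar_local [:: e; shift (pos e + arity_out e) f]
                   [:: shift (pos e + arity_in e) f; e]
  | PlanarZigzagL i a : planar_local [:: Cup i.+1 a; Cap i] [::]
  | PlanarZigzagR i a : planar_local [:: Cup i a; Cap i.+1] [::]
  | PlanarCupSlide i a b :
      planar_local [:: Cup i a; Cross i.+1 b] [:: Cup i.+1 a; Cross i (~~ b)]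
  | PlanarCapSlide i b :
      planar_local [:: Cross i.+1 b; Cap i] [:: Cross i (~~ b); Cap i.+1].

(* Every monogon, bigon or 3-gon face can be brought by an isotopy into one of
   the positions below.  The condition in RIII says that one of the three
   strands is above the other two. *)
Inductive RI (A : Type) : word A -> word A -> Prop :=
  | RIright i a b : RI [::] [:: Cup i.+1 a; Cross i b; Cap i.+1]
  | RIleft i a b : RI [::] [:: Cup i a; Cross i.+1 b; Cap i].

Inductive RII (A : Type) : word A -> word A -> Prop :=
  | RIIintro i b : RII [::] [:: Cross i b; Cross i (~~ b)].

Inductive RIII (A : Type) : word A -> word A -> Prop :=
  | RIIIintro i b1 b2 b3 of (b2 == b1) || (b2 == b3) :
      RIII [:: Cross i b1; Cross i.+1 b2; Cross i b3]
           [:: Cross i.+1 b3; Cross i b2; Cross i.+1 b1].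

Arguments RI {A}.
Arguments RII {A}.
Arguments RIII {A}.

(* Replacement of a subword.  That both sides are diagrams forces the
   decorations of the strands involved to be carried along. *)
Inductive replace (A : eqType) (opp : A -> A) (R : word A -> word A -> Prop) :
    word A -> word A -> Prop :=
  | Replace u v l r of
      R l r & is_diagram opp (u ++ l ++ v) & is_diagram opp (u ++ r ++ v) :
      replace opp R (u ++ l ++ v) (u ++ r ++ v).

(* Passage of an arc through the point at infinity of the 2-sphere: the
   leftmost strand at some height is swung across it, and the new arc goes down
   on the left, below, to the right, and back above the whole diagram. *)
Definition swing (A : Type) (a : A) (u v : word A) : word A :=
  Cup 0 a :: map (shift 1) u ++ [:: Cap 0; Cup 0 a]
    ++ map (shift 1) v ++ [:: Cap 0].

Inductive through_infinity (A : eqType) (opp : A -> A) :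
    word A -> word A -> Prop :=
  | ThroughInfinity u v a s of
      run opp u [::] = Some (opp a :: s) &
      is_diagram opp (u ++ v) & is_diagram opp (swing a u v) :
      through_infinity opp (u ++ v) (swing a u v).

Inductive isotopy_step (A : eqType) (opp : A -> A) (w w' : word A) : Prop :=
  | IsoPlanar of replace opp (@planar_local A) w w'
  | IsoSphere of through_infinity opp w w'.

Definition isotopic (A : eqType) (opp : A -> A) : word A -> word A -> Prop :=
  clos_refl_sym_trans (word A) (isotopy_step opp).

(* E is obtained from D by a single move of type R (creating or deleting);
   diagrams are considered up to isotopy in the 2-sphere. *)
Definition single_move (A : eqType) (opp : A -> A)
    (R : word A -> word A -> Prop) (D E : word A) : Prop :=
  exists D' E', [/\ isotopic opp D D',
    replace opp R D' E' \/ replace opp R E' D' & isotopic opp E' E].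

Inductive link_step (A : eqType) (opp : A -> A) (w w' : word A) : Prop :=
  | LinkIsotopy of isotopy_step opp w w'
  | LinkRI of replace opp RI w w'
  | LinkRII of replace opp RII w w'
  | LinkRIII of replace opp RIII w w'.

(* By Reidemeister's theorem, a link is identified with the set of its
   diagrams. *)
Definition link_of (A : eqType) (opp : A -> A) (w : word A) : set (word A) :=
  [set w' | clos_refl_sym_trans (word A) (link_step opp) w w'].

Inductive flip (A : Type) : word A -> word A -> Prop :=
  | Flip i b : flip [:: Cross i b] [:: Cross i (~~ b)].

Definition crossing_change (A : eqType) (opp : A -> A) :
    word A -> word A -> Prop :=
  replace opp (@flip A).

Definition uword : Type := word unit.

Definition uopp : unit -> unit := id.

(* Isotopies and Reidemeister moves are free, and k is the number of crossing
   changes. *)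
Inductive deform : nat -> uword -> uword -> Prop :=
  | DeformRefl w : deform 0 w w
  | DeformMove k w w' w'' of
      link_step uopp w w' \/ link_step uopp w' w & deform k w' w'' :
      deform k w w''
  | DeformChange k w w' w'' of
      crossing_change uopp w w' & deform k w' w'' : deform k.+1 w w''.

Definition circles (m : nat) : uword :=
  flatten (nseq m [:: Cup 0 tt; Cap 0]).

Definition trivial_link (m : nat) : set uword := link_of uopp (circles m).

(* Since moves and crossing changes preserve the number of components, m is
   necessarily the number of components of K. *)
Definition unlinkable_in (K : set uword) (k : nat) : Prop :=
  exists m w t, [/\ K w, trivial_link m t & deform k w t].

Definition unknotting_number (K : set uword) : nat :=
  xget 0%N [set k | unlinkable_in K k /\
                    forall j, unlinkable_in K j -> (k <= j)%N].

Local Open Scope ring_scope.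

Definition ostrand (n : nat) : eqType := ('I_n * bool)%type.

Definition oopp (n : nat) (x : ostrand n) : ostrand n := (x.1, ~~ x.2).

Definition oword (n : nat) : Type := word (ostrand n).

Definition forget (n : nat) (D : oword n) : uword :=
  map (map_event (fun _ => tt)) D.

(* (k, p) stands for the p-th strand from the left between the events k-1 and k
   of w; two such strands are adjacent when they are joined by an event. *)
Inductive adjacent (A : Type) (w : word A) : nat * nat -> nat * nat -> Prop :=
  | AdjLeft k e p of onth w k = Some e & (p < pos e)%N :
      adjacent w (k, p) (k.+1, p)
  | AdjRight k e p of onth w k = Some e :
      adjacent w (k, pos e + arity_in e + p)%N (k.+1, pos e + arity_out e + p)%N
  | AdjCup k i a of onth w k = Some (Cup i a) :
      adjacent w (k.+1, i) (k.+1, i.+1)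
  | AdjCap k i of onth w k = Some (Cap i) :
      adjacent w (k, i) (k, i.+1)
  | AdjCrossL k i b of onth w k = Some (Cross i b) :
      adjacent w (k, i) (k.+1, i.+1)
  | AdjCrossR k i b of onth w k = Some (Cross i b) :
      adjacent w (k, i.+1) (k.+1, i).

Definition same_component (A : Type) (w : word A) :
    nat * nat -> nat * nat -> Prop :=
  clos_refl_sym_trans (nat * nat) (adjacent w).

Definition strand_at (n : nat) (D : oword n) (x : nat * nat) :
    option (ostrand n) :=
  obind (fun s => onth s x.2) (run (@oopp n) (take x.1 D) [::]).

(* a diagram of an oriented link with n components numbered by 'I_n: every
   number is the number of exactly one component *)
Definition numbered_diagram (n : nat) (D : oword n) : Prop :=
  [/\ is_diagram (@oopp n) D,
      forall c : 'I_n, exists x o, strand_at D x = Some (c, o) &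
      forall (c : 'I_n) x x' o o',
        strand_at D x = Some (c, o) -> strand_at D x' = Some (c, o') ->
        same_component D x x'].

Definition oriented_link (n : nat) (L : set (oword n)) : Prop :=
  exists2 D, numbered_diagram D & L = link_of (@oopp n) D.

(* The k-th event of D, if it is a crossing: its type b, and its lower left and
   lower right strands. *)
Definition crossing_at (n : nat) (D : oword n) (k : nat) :
    option (bool * ostrand n * ostrand n) :=
  if onth D k is Some (Cross i b) then
    if run (@oopp n) (take k D) [::] is Some s then
      if drop i s is x :: y :: _ then Some (b, x, y) else None
    else None
  else None.

(* M c d where c, d are the components crossing at the k-th event *)
Definition entry (n : nat) (M : 'M[int]_n) (D : oword n) (k : nat) : int :=
  if crossing_at D k is Some (b, x, y) then M x.1 y.1 else 0.

(* The crossing with b = true is positive if both strands go upwards; reversing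
   one strand or changing b changes the sign. *)
Definition sign (n : nat) (D : oword n) (k : nat) : int :=
  if crossing_at D k is Some (b, x, y) then
    (if b then 1 else -1) * (if x.2 == y.2 then 1 else -1)
  else 0.

(* Replacement of a crossing by two vertical strands if vert holds, by a
   maximum with a minimum above it otherwise. *)
Definition smooth (vert : bool) (w : uword) (k : nat) : uword :=
  if onth w k is Some (Cross i _) then
    take k w ++ (if vert then [::] else [:: Cap i; Cup i tt]) ++ drop k.+1 w
  else w.

(* The vertical pasting connects orientations consistently iff both strands go
   upwards or both go downwards. *)
Definition parallel (n : nat) (D : oword n) (k : nat) : bool :=
  if crossing_at D k is Some (b, x, y) then x.2 == y.2 else false.

Definition regular_smoothing (n : nat) (D : oword n) (k : nat) : uword :=
  smooth (parallel D k) (forget D) k.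

Definition irregular_smoothing (n : nat) (D : oword n) (k : nat) : uword :=
  smooth (~~ parallel D k) (forget D) k.

Definition link_u (w : uword) : nat := unknotting_number (link_of uopp w).

Definition iu (n : nat) (S T : 'M[int]_n) (D : oword n) : int :=
  \sum_(k < size D | entry S D k == 1)
     entry T D k * sign D k *
       `|(link_u (regular_smoothing D k))%:Z - (link_u (forget D))%:Z| +
  \sum_(k < size D | entry S D k == -1)
     entry T D k * sign D k *
       `|(link_u (irregular_smoothing D k))%:Z - (link_u (forget D))%:Z|.

(* Main.v *)
From Stdlib Require Import Relation_Operators.
Require Import Defs.
From mathcomp Require Import all_boot all_order all_algebra.
From mathcomp Require Import boolp classical_sets.
From mathcomp Require Import zify.
Import Order.TTheory GRing.Theory Num.Theory.

Set Implicit Arguments.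
Unset Strict Implicit.
Unset Printing Implicit Defensive.

(* A move leaves the crossings outside its face and their smoothings unchanged
   up to the same kind of move, so only the crossings of the face matter.
   - RI: smoothing the kink gives either the original link, or its disjoint
     union with an unknot.  The latter has the same unknotting number: in a
     sequence that unlinks the union, one can erase the added component, which
     turns each step into a step of the same kind or into nothing.
   - RII: the two crossings have opposite signs, and their smoothings are related
     by a crossing change or both reduce to the same diagram.
   - RIII: crossings correspond with the same signs.  The smoothings of the
     crossings of the middle strand with the top and with the bottom strand agree
     before and after the move; those of the crossing of the top and bottom
     strands differ by two crossing changes.
   Nothing here requires that every link can be unlinked: two diagrams related
   by crossing changes are both unlinkable or both not. *)
(** * Numbers of strands and states *)

(** An irregular smoothing carries no orientation, so smoothed diagrams lose their decorations. Of
    an undecorated state only the number of strands remains, and fitting becomes the arithmetic of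
    [sz]. To confine the comparison to a face, the sum is cut along the word: a subword is evaluated
    against a function [g] that gives the deviation of the unknotting number when the subword is
    replaced. The main fact about [g] is that [d] crossing changes move it by at most [d], so the
    estimates reduce to relations between short undecorated words. Regular and irregular are
    translated into vertical and horizontal. Sliding a crossing past an extremum exchanges the
    latter two, so invariance under isotopy is a statement with content, and it rests on a symmetry
    of the weight of a crossing. Erasing a component meets an obstacle: an intermediate diagram of
    an unlinking sequence does not tell which component was added. The diagrams are therefore
    coloured, the colouring is transported along every step, including the passage through infinity,
    and erasing becomes a function of the coloured word. *)

Definition sz_event A (e : event A) (k : nat) : option nat :=
  if pos e + arity_in e <= k then Some (k - arity_in e + arity_out e) else None.

(* The number of strands above w when there are k strands below it. *)
Fixpoint sz A (w : word A) (k : nat) : option nat :=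
  if w is e :: w' then obind (sz w') (sz_event e k) else Some k.

Lemma sz_cat A (w1 w2 : word A) k : sz (w1 ++ w2) k = obind (sz w2) (sz w1 k).
Proof. by elim: w1 k => //= e w IH k; case: sz_event. Qed.

Lemma sz_map A B (f : A -> B) (w : word A) k : sz (map (map_event f) w) k = sz w k.
Proof.
elim: w k => //= e w IH k.
by have -> : sz_event (map_event f e) k = sz_event e k;
   [case: e | case: sz_event => /=].
Qed.

Lemma pos_shift A d (e : event A) : pos (shift d e) = d + pos e.
Proof. by case: e. Qed.

Lemma arity_in_shift A d (e : event A) : arity_in (shift d e) = arity_in e.
Proof. by case: e. Qed.

Lemma arity_out_shift A d (e : event A) : arity_out (shift d e) = arity_out e.
Proof. by case: e. Qed.

Lemma shift_shift A d d' (e : event A) : shift d (shift d' e) = shift (d + d') e.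
Proof. by case: e => //= *; rewrite addnA. Qed.

Lemma map_event_shift A B (f : A -> B) d e :
  map_event f (shift d e) = shift d (map_event f e).
Proof. by case: e. Qed.

Lemma map_map_shift A B (f : A -> B) d w :
  map (map_event f) (map (shift d) w) = map (shift d) (map (map_event f) w).
Proof. by elim: w => //= e w ->; rewrite map_event_shift. Qed.

Section Run.
Variables (A : eqType) (opp : A -> A).
Implicit Types (e : event A) (s p q : seq A) (w : word A).

Lemma run_cat w1 w2 s : run opp (w1 ++ w2) s = obind (run opp w2) (run opp w1 s).
Proof. by elim: w1 s => //= e w IH s; case: apply_event. Qed.

Lemma drop_cons2 i s : i + 2 <= size s ->
  exists x y s', drop i s = x :: y :: s'.
Proof.
move=> h; have := size_drop i s; case: (drop i s) => [|x [|y s']] /=; try lia.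
by exists x, y, s'.
Qed.

Lemma size_apply_event e s s' : apply_event opp e s = Some s' ->
  sz_event e (size s) = Some (size s').
Proof.
have h2 i : 1 < size (drop i s) -> i + 2 <= size s by rewrite size_drop; lia.
have ht i x y q : drop i s = x :: y :: q -> size (take i s) + size q + 2 = size s.
  by move=> E; rewrite -[in RHS](cat_take_drop i s) E size_cat /=; lia.
case: e => [i a|i|i b] /=; rewrite /sz_event /=.
- rewrite addn0 subn0; case: leqP => // h [<-].
  rewrite size_cat /= size_take size_drop; f_equal; case: ltnP; lia.
- case E: (drop i s) (h2 i) => [|x [|y q]] //= /(_ isT) h; case: eqP => // _ [<-].
  rewrite h size_cat; move/ht: E => E; f_equal; lia.
- case E: (drop i s) (h2 i) => [|x [|y q]] //= /(_ isT) h [<-].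
  rewrite h size_cat /=; move/ht: E => E; f_equal; lia.
Qed.

Lemma size_run w s s' : run opp w s = Some s' -> sz w (size s) = Some (size s').
Proof.
elim: w s => [|e w IH] s /=; first by case=> ->.
by case E: apply_event => [t|] //= /IH; rewrite (size_apply_event E).
Qed.

Lemma apply_event_shift p e s :
  apply_event opp (shift (size p) e) (p ++ s) = omap (cat p) (apply_event opp e s).
Proof.
have D i : drop (size p + i) (p ++ s) = drop i s.
  by rewrite drop_cat ltnNge leq_addr /= addKn.
have K i : take (size p + i) (p ++ s) = p ++ take i s.
  by rewrite take_cat ltnNge leq_addr /= addKn.
case: e => [i a|i|i b] /=; rewrite D K.
- by rewrite size_cat leq_add2l; case: ifP => //= _; rewrite catA.
- by case: (drop i s) => [|x [|y q]] //=; case: ifP => //= _; rewrite catA.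
- by case: (drop i s) => [|x [|y q]] //=; rewrite catA.
Qed.

Lemma apply_event_cat e s q : pos e + arity_in e <= size s ->
  apply_event opp e (s ++ q) = omap (cat^~ q) (apply_event opp e s).
Proof.
case: e => [i a|i|i b] /= h.
- have h' : i <= size s by lia.
  rewrite h' size_cat (leq_trans h' (leq_addr _ _)) /=.
  by rewrite drop_cat take_cat -catA /=; case: ltngtP h' => // -> _; rewrite subnn take0 drop0
    take_size drop_size cats0.
- have [x [y [s' E]]] := drop_cons2 h; have h' : i < size s by lia.
  by rewrite drop_cat take_cat h' E /=; case: ifP => //= _; rewrite catA.
- have [x [y [s' E]]] := drop_cons2 h; have h' : i < size s by lia.
  by rewrite drop_cat take_cat h' E /= -catA.
Qed.

Lemma run_shift p w s :
  run opp (map (shift (size p)) w) (p ++ s) = omap (cat p) (run opp w s).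
Proof.
elim: w s => //= e w IH s; rewrite apply_event_shift.
by case: apply_event => //= t; rewrite IH.
Qed.

Lemma sz_event_fit e k m : sz_event e k = Some m -> pos e + arity_in e <= k.
Proof. by rewrite /sz_event; case: ifP. Qed.

Lemma run_cat_state w s q m : sz w (size s) = Some m ->
  run opp w (s ++ q) = omap (cat^~ q) (run opp w s).
Proof.
elim: w s => //= e w IH s.
case E: sz_event => [k|] //= h.
rewrite (apply_event_cat _ (sz_event_fit E)).
case E': apply_event => [t|] //=.
by apply: IH; move: E; rewrite (size_apply_event E') => -[->].
Qed.

Lemma run_frame w p s q m : sz w (size s) = Some m ->
  run opp (map (shift (size p)) w) (p ++ s ++ q) =
  omap (fun t => p ++ t ++ q) (run opp w s).
Proof. by move=> h; rewrite run_shift (run_cat_state q h); case: run. Qed.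

End Run.

Lemma unit_nseq (s : seq unit) : s = nseq (size s) tt.
Proof. by elim: s => //= -[] s {1}->. Qed.

(** A unit state is determined by its length and a cap never rejects its two strands, so an
    undecorated word fits exactly when the counts do. *)
Lemma urun w s : run uopp w s = omap (nseq^~ tt) (sz w (size s)).
Proof.
elim: w s => [|e w IH] s /=; first by rewrite -unit_nseq.
case E: apply_event => [t|] /=; first by rewrite (size_apply_event E) /= IH.
rewrite /sz_event; case: ifP => // h; exfalso; move: h E.
case: e => [i a|i|i b] /=.
- by rewrite addn0 => ->.
- by move=> /drop_cons2[x [y [s' ->]]]; case: x y => -[].
- by move=> /drop_cons2[x [y [s' ->]]].
Qed.

Lemma udiagram w : is_diagram uopp w <-> sz w 0 = Some 0.
Proof.
rewrite /is_diagram urun /=; case: sz => [m|] //=; split; last by case=> ->.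
by case: m.
Qed.

Lemma sz_shift A (w : word A) d k m :
  sz w k = Some m -> sz (map (shift d) w) (d + k) = Some (d + m).
Proof.
elim: w k => [|e w IH] k /=; first by case=> ->.
rewrite {2}/sz_event pos_shift arity_in_shift arity_out_shift.
rewrite /sz_event; case: ifP => //= h /IH.
rewrite -addnA leq_add2l h /= => <-; f_equal; lia.
Qed.

Lemma sz_addr A (w : word A) d k m :
  sz w k = Some m -> sz w (k + d) = Some (m + d).
Proof.
elim: w k => [|e w IH] k /=; first by case=> ->.
rewrite /sz_event; case: ifP => //= h /IH.
have -> : pos e + arity_in e <= k + d by lia.
move=> /= <-; f_equal; lia.
Qed.

(** * Local moves *)

(* The boolean tells whether the move is a crossing change. *)
Inductive core_move A : bool -> word A -> word A -> Prop :=
  | CoreZigzagL a : core_move false [:: Cup 1 a; Cap 0] [::]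
  | CoreZigzagR a : core_move false [:: Cup 0 a; Cap 1] [::]
  | CoreCupSlide a b :
      core_move false [:: Cup 0 a; Cross 1 b] [:: Cup 1 a; Cross 0 (~~ b)]
  | CoreCapSlide b :
      core_move false [:: Cross 1 b; Cap 0] [:: Cross 0 (~~ b); Cap 1]
  | CoreRIright a b : core_move false [::] [:: Cup 1 a; Cross 0 b; Cap 1]
  | CoreRIleft a b : core_move false [::] [:: Cup 0 a; Cross 1 b; Cap 0]
  | CoreRII b : core_move false [::] [:: Cross 0 b; Cross 0 (~~ b)]
  | CoreRIII b1 b2 b3 of (b2 == b1) || (b2 == b3) :
      core_move false [:: Cross 0 b1; Cross 1 b2; Cross 0 b3]
                      [:: Cross 1 b3; Cross 0 b2; Cross 1 b1]
  | CoreFlip b : core_move true [:: Cross 0 b] [:: Cross 0 (~~ b)].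

(** The exchange involves two arbitrary events and stays apart; all other moves are translates of a
    finite list, so their case analyses can be carried out at position 0. *)
Inductive local_move A : bool -> word A -> word A -> Prop :=
  | LocalExchange e f :
      local_move false [:: e; shift (pos e + arity_out e) f]
                       [:: shift (pos e + arity_in e) f; e]
  | LocalCore i c l r of core_move c l r :
      local_move c (map (shift i) l) (map (shift i) r).

Definition ambient_move A (l r : word A) : Prop :=
  planar_local l r \/ RI l r \/ RII l r \/ RIII l r.

Lemma local_moveP A (l r : word A) :
  local_move false l r <-> ambient_move l r.
Proof.
split=> [h|].
  have [c ec {}h] : exists2 c, c = false & local_move c l r by exists false.
  case: c l r / h ec => [e f _|i {}c {}l {}r h]; first by left; constructor.
  case: c l r / h => [a|a|a b|b|a b|a b|b|b1 b2 b3 hb|b] // _;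
    rewrite /= ?addn0 ?addn1;
    by [left; constructor | right; left; constructor
       | right; right; left; constructor | right; right; right; constructor].
have E i l0 r0 : core_move false l0 r0 -> l = map (shift i) l0 ->
    r = map (shift i) r0 -> local_move false l r.
  by move=> h -> ->; constructor.
case=> [h|[h|[h|h]]].
- case: l r / h E => [e f|i a|i a|i a b|i b] E; first by constructor.
  + by apply: (E i _ _ (CoreZigzagL a)); rewrite //= ?addn0 ?addn1.
  + by apply: (E i _ _ (CoreZigzagR a)); rewrite //= ?addn0 ?addn1.
  + by apply: (E i _ _ (CoreCupSlide a b)); rewrite //= ?addn0 ?addn1.
  + by apply: (E i _ _ (CoreCapSlide _ b)); rewrite //= ?addn0 ?addn1.
- case: l r / h E => [i a b|i a b] E.
  + by apply: (E i _ _ (CoreRIright a b)); rewrite //= ?addn0 ?addn1.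
  + by apply: (E i _ _ (CoreRIleft a b)); rewrite //= ?addn0 ?addn1.
- case: l r / h E => [i b] E.
  by apply: (E i _ _ (CoreRII _ b)); rewrite //= ?addn0 ?addn1.
- case: l r / h E => [i b1 b2 b3 hb] E.
  by apply: (E i _ _ (CoreRIII _ hb)); rewrite //= ?addn0 ?addn1.
Qed.

Lemma local_flipP A (l r : word A) : local_move true l r <-> flip l r.
Proof.
split=> [h|[i b]].
  have [c ec {}h] : exists2 c, c = true & local_move c l r by exists true.
  case: c l r / h ec => // i {}c {}l {}r h.
  case: c l r / h => //.
have := LocalCore i (CoreFlip A b).
by rewrite /= addn0.
Qed.

Lemma local_move_shift A c (l r : word A) d : local_move c l r ->
  local_move c (map (shift d) l) (map (shift d) r).
Proof.
case=> [e f|i {}c {}l {}r h] /=.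
  rewrite !shift_shift !addnA -!(pos_shift d).
  rewrite -{1}(arity_out_shift d) -{1}(arity_in_shift d).
  by constructor.
rewrite -!map_comp.
have E (w : word A) : map (shift d \o shift i) w = map (shift (d + i)) w.
  by apply: eq_map => e; exact: shift_shift.
by rewrite !E; constructor.
Qed.

Lemma split_size T (s : seq T) i :
  i <= size s -> exists p t, s = p ++ t /\ size p = i.
Proof.
by move=> h; exists (take i s), (drop i s); rewrite cat_take_drop size_takel.
Qed.

Section RunMove.
Variables (A : eqType) (opp : A -> A).
Hypothesis oppK : involutive opp.

(** Both sides are assumed to fit, because one may be pickier than the other: a zigzag prescribes
    the decoration of its strand, while the empty word accepts any. *)
Lemma core_move_run c l r s s1 s2 : core_move c l r ->
  run opp l s = Some s1 -> run opp r s = Some s2 -> s1 = s2.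
Proof.
case=> [a|a|a b|b|a b|a b|b|b1 b2 b3 _|b].
- case: s => [|x s] //=; rewrite drop0 take0 /=.
  by case: eqP => //= -> [<-] [<-]; rewrite oppK.
- case: s => [|x s] //=.
  by case: eqP => //= -> [<-] [<-]; rewrite oppK.
- by case: s => [|x s] //=; rewrite drop0 take0 /= => -[<-] [<-].
- case: s => [|x [|y [|z s]]] //=.
  by case: eqP => //= _ [<-]; rewrite ?drop0 ?take0 /= => -[<-].
- case: s => [|x s] //=; rewrite ?drop0 ?take0 /=.
  by case: eqP => //= /(can_inj oppK)-> [<-] [<-].
- case: s => [|x s] //=; rewrite ?drop0 ?take0 /=.
  by case: eqP => //= -> [<-] [<-].
- by case: s => [|x [|y s]] //= [<-] [<-]; rewrite ?drop0.
- by case: s => [|x [|y [|z s]]] //= [<-] [<-]; rewrite ?drop0.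
- by case: s => [|x [|y s]] //= [<-] [<-].
Qed.

Lemma exchange_run e f p t p' t' :
  size p = pos e + arity_in e -> apply_event opp e p = Some p' ->
  apply_event opp f t = Some t' ->
  [/\ size p' = pos e + arity_out e,
      run opp [:: e; shift (pos e + arity_out e) f] (p ++ t) = Some (p' ++ t') &
      run opp [:: shift (pos e + arity_in e) f; e] (p ++ t) = Some (p' ++ t')].
Proof.
move=> sp hp ht.
have sp' : size p' = pos e + arity_out e.
  move: (size_apply_event hp); rewrite /sz_event sp leqnn => -[<-]; lia.
have le : pos e + arity_in e <= size p by rewrite sp.
split=> //=; rewrite -?sp -?sp'.
  by rewrite (apply_event_cat _ _ le) hp /= apply_event_shift ht.
by rewrite apply_event_shift ht /= (apply_event_cat _ _ le) hp.
Qed.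

(** The strands up to the last one consumed by [e] form a block [p], and [f] acts on the rest [t].
    The two orders perform the same computations on disjoint blocks. *)
Lemma exchange_split e f s s' :
  run opp [:: e; shift (pos e + arity_out e) f] s = Some s' \/
  run opp [:: shift (pos e + arity_in e) f; e] s = Some s' ->
  exists p t p' t', [/\ s = p ++ t, size p = pos e + arity_in e,
    apply_event opp e p = Some p', apply_event opp f t = Some t' & s' = p' ++ t'].
Proof.
move=> h.
have [|p [t [es sp]]] := @split_size _ s (pos e + arity_in e).
  case: h => /=.
    by case E: apply_event => [u|] //= _; exact: (sz_event_fit (size_apply_event E)).
  case E: apply_event => [u|] //= _.
  by have := sz_event_fit (size_apply_event E); rewrite pos_shift; lia.
exists p, t; rewrite es in h.
have le : pos e + arity_in e <= size p by rewrite sp.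
case: h => /=.
  rewrite (apply_event_cat _ _ le).
  case E: apply_event => [p'|] //=.
  have sp' : size p' = pos e + arity_out e.
    move: (size_apply_event E); rewrite /sz_event sp leqnn => -[<-]; lia.
  rewrite -sp' apply_event_shift; case E': apply_event => [t'|] //= [<-].
  by exists p', t'.
rewrite -sp apply_event_shift; case E': apply_event => [t'|] //=.
rewrite (apply_event_cat _ _ le).
case E: apply_event => [p'|] //= [<-].
by exists p', t'.
Qed.

(** An empty side fits anywhere, so both runs are assumed; at least one side is nonempty, and its
    first event sits at position [i] or further right. *)
Lemma core_move_pos c (l r : word A) i s s1 s2 : core_move c l r ->
  run opp (map (shift i) l) s = Some s1 -> run opp (map (shift i) r) s = Some s2 ->
  i <= size s.
Proof.
move=> h; case: i => // i.
have H e w u : run opp (e :: w) s = Some u -> pos e + arity_in e <= size s.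
  by move=> /=; case E: apply_event => //= _; exact: sz_event_fit (size_apply_event E).
case: c l r / h => [a|a|a b|b|a b|a b|b|b1 b2 b3 _|b]; rewrite ?map_cons;
by [move=> /H /= h _; lia | move=> _ /H /= h; lia].
Qed.

Lemma local_move_run c l r s s1 s2 : local_move c l r ->
  run opp l s = Some s1 -> run opp r s = Some s2 -> s1 = s2.
Proof.
case=> [e f|i {}c {}l {}r h] h1 h2.
  have [|p [t [p' [t' [es sp hp ht ->]]]]] := @exchange_split e f s s1; first by left.
  rewrite es in h2.
  by have [_ _] := exchange_run sp hp ht; rewrite h2 => -[].
have [p [t [es ei]]] := split_size (core_move_pos h h1 h2).
move: h1 h2; rewrite es -ei !run_shift.
case E: run => [u|] //= [<-]; case E': run => [u'|] //= [<-].
by rewrite (core_move_run h E E').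
Qed.

End RunMove.

(** * Unknotting numbers *)

Lemma deform_trans a b w1 w2 w3 :
  deform a w1 w2 -> deform b w2 w3 -> deform (a + b) w1 w3.
Proof.
move=> h; elim: h => // [k u v x h _ IH|k u v x h _ IH] /IH.
  by apply: DeformMove.
by rewrite addSn; apply: DeformChange.
Qed.

Lemma deform_step w w' : link_step uopp w w' \/ link_step uopp w' w -> deform 0 w w'.
Proof. by move=> h; apply: DeformMove h (DeformRefl _). Qed.

Lemma crossing_change_sym (A : eqType) (opp : A -> A) w w' :
  crossing_change opp w w' -> crossing_change opp w' w.
Proof.
case=> u v l r [i b] h1 h2; apply: Replace => //.
by rewrite -{2}(negbK b); constructor.
Qed.

Lemma deform_sym k w w' : deform k w w' -> deform k w' w.
Proof.
elim=> [u|{}k u v x h _ IH|{}k u v x /crossing_change_sym h _ IH].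
- exact: DeformRefl.
- by rewrite -[k]addn0; apply: deform_trans IH (deform_step _); case: h; [right|left].
- by rewrite -addn1; apply: deform_trans IH _; apply: DeformChange h (DeformRefl _).
Qed.

Lemma deform0P w w' : clos_refl_sym_trans _ (link_step uopp) w w' <-> deform 0 w w'.
Proof.
split.
  elim=> [u v h|u|u v _ IH|u v x _ h1 _ h2].
  - by apply: deform_step; left.
  - exact: DeformRefl.
  - exact: deform_sym.
  - exact: deform_trans h1 h2.
move ek: 0 => k h; elim: h ek => [u _|{}k u v x h _ IH /IH|//].
  exact: rst_refl.
by apply: rst_trans; case: h => h; [apply: rst_step|apply/rst_sym/rst_step].
Qed.

(** An upper bound rather than an exact count, since erasing a component may turn a crossing change
    into nothing. *)
Definition near d w w' := exists2 k, k <= d & deform k w w'.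

Lemma near_refl d w : near d w w.
Proof. by exists 0 => //; constructor. Qed.

Lemma near_sym d w w' : near d w w' -> near d w' w.
Proof. by case=> k h /deform_sym; exists k. Qed.

Lemma near_trans a b w1 w2 w3 :
  near a w1 w2 -> near b w2 w3 -> near (a + b) w1 w3.
Proof. by case=> k ha h [j hb h']; exists (k + j);
  [lia | apply: deform_trans h h']. Qed.

(** The boolean [c], read as a number, is the cost of the move: 1 for a crossing change, 0 for the
    moves that are free. *)
Lemma near_local c l r u v :
  local_move c l r -> sz (u ++ l ++ v) 0 = Some 0 -> sz (u ++ r ++ v) 0 = Some 0 ->
  near c (u ++ l ++ v) (u ++ r ++ v).
Proof.
move=> h /udiagram h1 /udiagram h2; exists c => //.
have E (R : uword -> uword -> Prop) : R l r -> replace uopp R (u ++ l ++ v) (u ++ r ++ v).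
  by move=> h'; constructor.
case: c h => [/local_flipP h|/local_moveP[h|[h|[h|h]]]].
- by apply: (DeformChange (E _ h)); constructor.
- by apply/deform_step; left; constructor; constructor; apply: E.
- by apply/deform_step; left; apply: LinkRI; apply: E.
- by apply/deform_step; left; apply: LinkRII; apply: E.
- by apply/deform_step; left; apply: LinkRIII; apply: E.
Qed.

(** Quantifying over all contexts makes this relation a congruence for concatenation, so long
    deformations can be assembled from short words. The counts [k] and [m] ensure that each
    replacement yields a diagram again. *)
Definition nearby d k l r := exists m, [/\ sz l k = Some m, sz r k = Some m &
  forall u v, sz u 0 = Some k -> sz v m = Some 0 -> near d (u ++ l ++ v) (u ++ r ++ v)].

Lemma nearby_refl d k l m : sz l k = Some m -> nearby d k l l.
Proof. by move=> h; exists m; split=> // u v _ _; apply: near_refl. Qed.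

Lemma nearby_sym d k l r : nearby d k l r -> nearby d k r l.
Proof. by case=> m [hl hr h]; exists m; split=> // u v hu hv; apply/near_sym/h. Qed.

Lemma nearby_trans a b k w1 w2 w3 :
  nearby a k w1 w2 -> nearby b k w2 w3 -> nearby (a + b) k w1 w3.
Proof.
case=> m [h1 h2 h] [m' [h2' h3 h']]; exists m.
have em : m' = m by move: h2'; rewrite h2 => -[].
rewrite em in h3 h'; split=> // u v hu hv.
exact: near_trans (h _ _ hu hv) (h' _ _ hu hv).
Qed.

Lemma nearby_ctx d k k' m u v l r :
  sz u k = Some k' -> nearby d k' l r -> sz (u ++ l ++ v) k = Some m ->
  nearby d k (u ++ l ++ v) (u ++ r ++ v).
Proof.
move=> hu [m' [hl hr h]]; rewrite !sz_cat hu /= sz_cat hl /= => hv.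
exists m; split; rewrite ?sz_cat ?hu /= ?sz_cat ?hl ?hr //= => u' v' hu' hv'.
have := h (u' ++ u) (v ++ v'); rewrite !catA; apply; rewrite sz_cat ?hu' //=.
by rewrite hv /= hv'.
Qed.

Lemma nearby_catl d k k' u l r :
  sz u k = Some k' -> nearby d k' l r -> nearby d k (u ++ l) (u ++ r).
Proof.
move=> hu h; case: (h) => m [hl hr _].
have := @nearby_ctx d k k' m u [::] l r hu h.
by rewrite !cats0 sz_cat hu /=; apply.
Qed.

Lemma nearby_catr d k m v l r :
  nearby d k l r -> sz (l ++ v) k = Some m -> nearby d k (l ++ v) (r ++ v).
Proof. by move=> h hv; apply: (@nearby_ctx d k k m [::]). Qed.

Lemma nearby_move c k l r m m' : local_move c l r ->
  sz l k = Some m -> sz r k = Some m' -> nearby c k l r.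
Proof.
move=> h hl hr.
have em : m = m'.
  (* The two sides lead to the same unit state, and the length of that state is the number of
     strands. *)
  have := local_move_run (opp := uopp) (fun _ => erefl) h (s := nseq k tt).
  rewrite !urun !size_nseq hl hr => /(_ _ _ erefl erefl) /(congr1 size).
  by rewrite !size_nseq.
rewrite -em in hr; exists m; split=> // u v hu hv.
by apply: near_local => //; rewrite sz_cat hu /= sz_cat ?hl ?hr.
Qed.

Lemma near_near0 d w w' : nearby d 0 w w' -> sz w 0 = Some 0 -> near d w w'.
Proof.
case=> m [hw hw' h] hw0; have := h [::] [::] erefl; rewrite !cats0; apply.
by move: hw; rewrite hw0 => -[<-].
Qed.

(** * Unknotting numbers as minima *)

Lemma unlinkableP w k :
  unlinkable_in (link_of uopp w) k <-> exists m, deform k w (circles m).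
Proof.
split=> [[m [w' [t [/= /deform0P h1 /deform0P h2 h]]]]|[m h]].
  exists m; rewrite -[k]addn0; apply: deform_trans (deform_sym h2).
  exact: deform_trans h1 h.
by exists m, w, (circles m); split=> //; apply: rst_refl.
Qed.

Definition unlinks w k := exists m, deform k w (circles m).

Lemma link_u_spec w : (exists k, unlinks w k) ->
  unlinks w (link_u w) /\ forall j, unlinks w j -> link_u w <= j.
Proof.
case=> k0 hk0.
have [k [hk mk]] : exists k, unlinks w k /\ forall j, unlinks w j -> k <= j.
  (* [unlinks] is not decidable; its classical truth value makes the search for a least element
     available. *)
  have ex : exists k, `[< unlinks w k >] by exists k0; apply/asboolP.
  case: (ex_minnP ex) => k /asboolP hk mk; exists k; split=> // j hj.
  by apply: mk; apply/asboolP.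
rewrite /link_u /unknotting_number; set P := [set k | _]%classic.
have Pk : P k by split; [apply/unlinkableP | move=> j /unlinkableP; apply: mk].
have [/unlinkableP h1 h2] := xgetI 0 Pk.
by split=> // j hj; apply/h2/unlinkableP.
Qed.

Lemma link_u_none w : ~ (exists k, unlinks w k) -> link_u w = 0.
Proof.
by move=> h; apply: xgetPN => k [/unlinkableP hk _]; apply: h; exists k.
Qed.

Lemma link_u_le d w w' :
  (forall k, unlinks w k -> exists2 k', k' <= k + d & unlinks w' k') ->
  (exists k, unlinks w' k) -> (exists k, unlinks w k) -> link_u w' <= link_u w + d.
Proof.
move=> h ex' /link_u_spec[hw _]; have [k' le hk'] := h _ hw.
by have [_ /(_ _ hk')] := link_u_spec ex'; lia.
Qed.

(* If neither diagram could be unlinked, both unknotting numbers would take the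
   junk value 0. *)
Lemma link_u_close d w w' :
  (forall k, unlinks w k -> exists2 k', k' <= k + d & unlinks w' k') ->
  (forall k, unlinks w' k -> exists2 k', k' <= k + d & unlinks w k') ->
  link_u w' <= link_u w + d /\ link_u w <= link_u w' + d.
Proof.
move=> h h'; have [ex|nex] := pselect (exists k, unlinks w k).
  have ex' : exists k, unlinks w' k by case: ex => k /h[k' _]; exists k'.
  by split; apply: link_u_le.
rewrite (link_u_none nex) link_u_none; first by split.
by case=> k /h'[k' _ ?]; apply: nex; exists k'.
Qed.

Lemma near_unlinks d w w' k : near d w w' ->
  unlinks w' k -> exists2 k', k' <= k + d & unlinks w k'.
Proof.
case=> j le h [m h']; exists (j + k); first by lia.
by exists m; apply: deform_trans h h'.
Qed.

Lemma link_u_near d w w' : near d w w' ->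
  link_u w' <= link_u w + d /\ link_u w <= link_u w' + d.
Proof.
by move=> h; apply: link_u_close => k; apply: near_unlinks => //; apply: near_sym.
Qed.

Lemma link_u_near0 w w' : near 0 w w' -> link_u w = link_u w'.
Proof. by move=> /link_u_near; lia. Qed.

(** * Removing kinks and moving circles *)

Ltac sz_tac :=
  rewrite /= /sz_event /=; repeat (rewrite ifT /=; [|lia]); by [|congr Some; lia].

Lemma nearby_cat0 d k k' m u v l r :
  nearby 0 k' l r -> sz u k = Some k' -> sz (u ++ l ++ v) k = Some m ->
  forall w, nearby d k (u ++ r ++ v) w -> nearby d k (u ++ l ++ v) w.
Proof.
by move=> h hu hm w; apply: (nearby_trans (a := 0)); apply: nearby_ctx hu h hm.
Qed.

Lemma nearby_exchange e f k m m' :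
  sz [:: e; shift (pos e + arity_out e) f] k = Some m ->
  sz [:: shift (pos e + arity_in e) f; e] k = Some m' ->
  nearby 0 k [:: e; shift (pos e + arity_out e) f]
             [:: shift (pos e + arity_in e) f; e].
Proof. exact: (@nearby_move false _ _ _ _ _ (LocalExchange e f)). Qed.

Lemma nearby_planar l r k m m' : planar_local l r ->
  sz l k = Some m -> sz r k = Some m' -> nearby 0 k l r.
Proof. by move=> h; apply: (@nearby_move false); apply/local_moveP; left. Qed.

Lemma nearby_RI l r k m m' : RI l r ->
  sz l k = Some m -> sz r k = Some m' -> nearby 0 k l r.
Proof. by move=> h; apply: (@nearby_move false); apply/local_moveP; right; left. Qed.

Lemma nearby_RII i b k : i + 2 <= k ->
  nearby 0 k [::] [:: Cross i b; Cross i (~~ b)].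
Proof.
move=> h; apply: (@nearby_move false _ _ _ k k); [|done|sz_tac].
by apply/local_moveP; right; right; left.
Qed.

Lemma nearby_flip i b k : i + 2 <= k ->
  nearby 1 k [:: Cross i b] [:: Cross i (~~ b)].
Proof.
move=> h; apply: (@nearby_move true _ _ _ k k); [|sz_tac|sz_tac].
exact/local_flipP.
Qed.

(** The RI moves at hand straighten a kink on a through strand, whereas here the crossing joins the
    two ends of a minimum. A zigzag inserted above supplies a maximum; sliding the crossing past it
    produces the standard kink. *)
Lemma cup_kink i b k : i <= k -> nearby 0 k [:: Cup i tt; Cross i b] [:: Cup i tt].
Proof.
move=> h.
have e1 : nearby 0 k.+2 [::] [:: Cup i tt; Cap i.+1].
  by apply/nearby_sym/(nearby_planar (m := k.+2) (m' := k.+2) (PlanarZigzagR i tt));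
    sz_tac.
have e2 : nearby 0 k.+2 [:: Cross i b; Cup i tt] [:: Cup i tt; Cross i.+2 b].
  have := @nearby_exchange (Cup i tt) (Cross 0 b) k.+2 k.+4 k.+4.
  rewrite /= !addn0 addn2 => H; apply/nearby_sym/H; sz_tac.
have e3 : nearby 0 k [:: Cup i tt; Cup i tt] [:: Cup i tt; Cup i.+2 tt].
  have := @nearby_exchange (Cup i tt) (Cup 0 tt) k k.+4 k.+4.
  rewrite /= !addn0 addn2 => H; apply/nearby_sym/H; sz_tac.
have e4 : nearby 0 k.+4 [:: Cross i.+2 b; Cap i.+1] [:: Cross i.+1 (~~ b); Cap i.+2].
  by apply: (nearby_planar (m := k.+2) (m' := k.+2) (PlanarCapSlide _ i.+1 b)); sz_tac.
have e5 : nearby 0 k.+2 [:: Cup i.+2 tt; Cross i.+1 (~~ b); Cap i.+2] [::].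
  by apply/nearby_sym/(nearby_RI (m := k.+2) (m' := k.+2) (RIright i.+1 tt (~~ b)));
    sz_tac.
apply: (@nearby_cat0 0 k k.+2 k.+2 [:: Cup i tt; Cross i b] [::] [::] _ e1);
  [sz_tac..|].
apply: (@nearby_cat0 0 k k.+2 k.+2 [:: Cup i tt] [:: Cap i.+1] _ _ e2); [sz_tac..|].
apply: (@nearby_cat0 0 k k.+4 k.+2 [:: Cup i tt; Cup i tt] [::] _ _ e4); [sz_tac..|].
apply: (@nearby_cat0 0 k k k.+2 [::] [:: Cross i.+1 (~~ b); Cap i.+2] _ _ e3);
  [sz_tac..|].
apply: (@nearby_cat0 0 k k.+2 k.+2 [:: Cup i tt] [::] _ _ e5); [sz_tac..|].
by apply: (@nearby_refl _ _ _ k.+2); sz_tac.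
Qed.

Lemma cap_kink i b k : i + 2 <= k -> nearby 0 k [:: Cross i b; Cap i] [:: Cap i].
Proof.
case: k => [|[|k]]; try lia.
move=> h; have {}h : i <= k by lia.
have e1 : nearby 0 k.+2 [::] [:: Cup i.+1 tt; Cap i].
  by apply/nearby_sym/(nearby_planar (m := k.+2) (m' := k.+2) (PlanarZigzagL i tt));
    sz_tac.
have e2 : nearby 0 k.+4 [:: Cap i; Cross i b] [:: Cross i.+2 b; Cap i].
  have := @nearby_exchange (Cap i) (Cross 0 b) k.+4 k.+2 k.+2.
  rewrite /= !addn0 addn2 => H; apply: H; sz_tac.
have e3 : nearby 0 k.+4 [:: Cap i; Cap i] [:: Cap i.+2; Cap i].
  have := @nearby_exchange (Cap i) (Cap 0) k.+4 k k.
  rewrite /= !addn0 addn2 => H; apply: H; sz_tac.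
have e4 : nearby 0 k.+2 [:: Cup i.+1 tt; Cross i.+2 b] [:: Cup i.+2 tt; Cross i.+1 (~~ b)].
  by apply: (nearby_planar (m := k.+4) (m' := k.+4) (PlanarCupSlide i.+1 tt b)); sz_tac.
have e5 : nearby 0 k.+2 [:: Cup i.+2 tt; Cross i.+1 (~~ b); Cap i.+2] [::].
  by apply/nearby_sym/(nearby_RI (m := k.+2) (m' := k.+2) (RIright i.+1 tt (~~ b)));
    sz_tac.
apply: (@nearby_cat0 0 k.+2 k.+2 k [::] [:: Cross i b; Cap i] [::] _ e1); [sz_tac..|].
apply: (@nearby_cat0 0 k.+2 k.+4 k [:: Cup i.+1 tt] [:: Cap i] _ _ e2); [sz_tac..|].
apply: (@nearby_cat0 0 k.+2 k.+4 k [:: Cup i.+1 tt; Cross i.+2 b] [::] _ _ e3);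
  [sz_tac..|].
apply: (@nearby_cat0 0 k.+2 k.+2 k [::] [:: Cap i.+2; Cap i] _ _ e4); [sz_tac..|].
apply: (@nearby_cat0 0 k.+2 k.+2 k [::] [:: Cap i] _ _ e5); [sz_tac..|].
by apply: (@nearby_refl _ _ _ k); sz_tac.
Qed.

(** The circle is pulled across the strand on its left: an RII move creates two crossings, one
    slides past the minimum and the other past the maximum, and the pair then cancels on the other
    side. *)
Lemma circle_left i k : i < k ->
  nearby 0 k [:: Cup i.+1 tt; Cap i.+1] [:: Cup i tt; Cap i].
Proof.
move=> h.
have e1 := @nearby_RII i true k.+2 ltac:(lia).
have e2 : nearby 0 k [:: Cup i.+1 tt; Cross i true] [:: Cup i tt; Cross i.+1 false].
  by apply/nearby_sym/(nearby_planar (m := k.+2) (m' := k.+2) (PlanarCupSlide i tt false));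
    sz_tac.
have e3 : nearby 0 k.+2 [:: Cross i false; Cap i.+1] [:: Cross i.+1 true; Cap i].
  by apply/nearby_sym/(nearby_planar (m := k) (m' := k) (PlanarCapSlide _ i true));
    sz_tac.
have e4 := nearby_sym (@nearby_RII i.+1 false k.+2 ltac:(lia)).
apply: (@nearby_cat0 0 k k.+2 k [:: Cup i.+1 tt] [:: Cap i.+1] [::] _ e1); [sz_tac..|].
apply: (@nearby_cat0 0 k k k [::] [:: Cross i false; Cap i.+1] _ _ e2); [sz_tac..|].
apply: (@nearby_cat0 0 k k.+2 k [:: Cup i tt; Cross i.+1 false] [::] _ _ e3);
  [sz_tac..|].
apply: (@nearby_cat0 0 k k.+2 k [:: Cup i tt] [:: Cap i] _ _ e4); [sz_tac..|].
by apply: (@nearby_refl _ _ _ k); sz_tac.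
Qed.

Notation circle i := [:: Cup i tt; Cap i].

Lemma sz_circle i k : i <= k -> sz (circle i) k = Some k.
Proof. by move=> h; sz_tac. Qed.

Lemma circle_zero i k : i <= k -> nearby 0 k (circle i) (circle 0).
Proof.
elim: i => [|i IH] h; first exact: nearby_refl (sz_circle h).
by apply: (nearby_trans (a := 0) (b := 0) (circle_left h)); apply: IH; lia.
Qed.

(** No strand lies to the left of the circle, so each event passes it by two exchanges of heights,
    one with the maximum and one with the minimum. *)
Lemma circle_up (w : uword) k m : sz w k = Some m ->
  nearby 0 k (circle 0 ++ w) (w ++ circle 0).
Proof.
elim: w k => [|e w IH] k.
  by move=> _; apply: (@nearby_refl _ _ _ k); apply: sz_circle.
rewrite [sz _ _]/=; case E: sz_event => [k'|] //= h.
have ek : sz [:: e] k = Some k' by rewrite /= E.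
have ek2 : sz [:: shift 2 e] k.+2 = Some k'.+2.
  by have := sz_shift 2 ek; rewrite !add2n.
have shift0 : shift 0 e = e by case: (e).
have e1 : nearby 0 k.+2 [:: Cap 0; e] [:: shift 2 e; Cap 0].
  have := @nearby_exchange (Cap 0) e k.+2 k' k'; rewrite /= shift0 !add0n; apply.
    by rewrite subn2 addn0 E.
  by move: ek2 => /=; case: sz_event => //= a [->] /=; rewrite subn2 addn0.
have e2 : nearby 0 k [:: Cup 0 tt; shift 2 e] [:: e; Cup 0 tt].
  have := @nearby_exchange (Cup 0 tt) e k k'.+2 k'.+2; rewrite /= shift0 !add0n; apply.
    by rewrite subn0 addn2; exact: ek2.
  by rewrite E /= subn0 addn2.
have e3 := IH _ h.
have sc : sz (circle 0) k = Some k by apply: sz_circle.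
have sc' : sz (circle 0) k' = Some k' by apply: sz_circle.
have s1 : sz (circle 0 ++ e :: w) k = Some m by rewrite sz_cat sc /= E.
have s2 : sz ([:: Cup 0 tt; shift 2 e; Cap 0] ++ w) k = Some m.
  rewrite (sz_cat [:: Cup 0 tt] ([:: shift 2 e; Cap 0] ++ w)).
  rewrite (_ : sz _ k = Some k.+2); last by sz_tac.
  rewrite [obind _ _](sz_cat [:: shift 2 e] (Cap 0 :: w)) ek2.
  by rewrite /= subn2 addn0.
have s3 : sz (e :: circle 0 ++ w) k = Some m.
  by rewrite (sz_cat [:: e]) ek [obind _ _](sz_cat (circle 0)) sc'.
have s4 : sz (e :: w ++ circle 0) k = Some m.
  by rewrite (sz_cat [:: e]) ek [obind _ _](sz_cat w) h; apply: sz_circle.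
apply: (@nearby_cat0 0 k k.+2 m [:: Cup 0 tt] w _ _ e1 _ s1); first by sz_tac.
apply: (@nearby_cat0 0 k k m [::] (Cap 0 :: w) _ _ e2 erefl s2).
have := @nearby_cat0 0 k k' m [:: e] [::] _ _ e3 ek; rewrite !cats0; apply=> //.
exact: nearby_refl s4.
Qed.

Lemma circle_top i u v k : sz u 0 = Some k -> sz v k = Some 0 -> i <= k ->
  near 0 (u ++ circle i ++ v) ((u ++ v) ++ circle 0).
Proof.
move=> hu hv h.
have hs : sz (u ++ circle i ++ v) 0 = Some 0.
  by rewrite sz_cat hu [obind _ _](sz_cat (circle i)) (sz_circle h).
apply: near_near0 => //.
apply: (@nearby_cat0 0 0 k 0 u v _ _ (circle_zero h)) => //.
rewrite -catA; apply: nearby_catl hu _; exact: circle_up hv.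
Qed.

Lemma replaceW (A : eqType) (opp : A -> A) (R R' : word A -> word A -> Prop) w w' :
  (forall l r, R l r -> R' l r) -> replace opp R w w' -> replace opp R' w w'.
Proof. by move=> h [u v l r /h h' h1 h2]; constructor. Qed.

Lemma link_stepP (A : eqType) (opp : A -> A) w w' : link_step opp w w' ->
  replace opp (@local_move A false) w w' \/ through_infinity opp w w'.
Proof.
case=> [[h|h]|h|h|h]; try by [right]; left; apply: replaceW h => l r h;
  apply/local_moveP; [by left|by right; left|by do 2 right; left|by do 3 right].
Qed.

Lemma crossing_changeP (A : eqType) (opp : A -> A) w w' :
  crossing_change opp w w' -> replace opp (@local_move A true) w w'.
Proof. by apply: replaceW => l r /local_flipP. Qed.

Lemma sz_swing A (a : A) u v k : sz u 0 = Some k.+1 -> sz v k.+1 = Some 0 ->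
  sz (swing a u v) 0 = Some 0.
Proof.
move=> hu hv; rewrite /swing [sz _ _]/= /sz_event /= sz_cat.
rewrite (_ : sz (map _ u) 2 = Some k.+3); last first.
  by rewrite -[2]/(1 + (0 + 1)) (sz_shift 1 (sz_addr 1 hu)); congr Some; lia.
rewrite [obind _ _]/= /sz_event /= subn2 /= subn0 addn0 addn2 sz_cat.
rewrite (_ : sz (map _ v) k.+3 = Some 2) //.
have := sz_shift 1 (sz_addr 1 hv); rewrite (_ : 1 + (k.+1 + 1) = k.+3); last by lia.
by [].
Qed.

Lemma near_infinity u v k : sz u 0 = Some k.+1 -> sz v k.+1 = Some 0 ->
  near 0 (u ++ v) (swing tt u v).
Proof.
move=> hu hv; exists 0 => //; apply: deform_step; left.
apply/LinkIsotopy/IsoSphere/(ThroughInfinity (s := nseq k tt)).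
- by rewrite urun hu.
- by apply/udiagram; rewrite sz_cat hu.
- by apply/udiagram; apply: sz_swing hu hv.
Qed.

Lemma infinity_sz (A : eqType) (opp : A -> A) w w' : through_infinity opp w w' ->
  exists u v a k, [/\ w = u ++ v, w' = swing a u v, sz u 0 = Some k.+1 & sz v k.+1 = Some 0].
Proof.
case=> u v a s hu; rewrite /is_diagram run_cat hu /= => hv _.
by exists u, v, a, (size s); rewrite (size_run hu) (size_run hv).
Qed.

Lemma diagram_sz (A : eqType) (opp : A -> A) w : is_diagram opp w -> sz w 0 = Some 0.
Proof. exact: size_run. Qed.

Lemma near_replace_circle c w w' : replace uopp (@local_move unit c) w w' ->
  near c (w ++ circle 0) (w' ++ circle 0).
Proof.
case=> u v l r h /udiagram h1 /udiagram h2; rewrite -!catA.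
by apply: near_local => //; rewrite !catA sz_cat -!catA ?h1 ?h2.
Qed.

Lemma near_step_circle w w' : link_step uopp w w' ->
  near 0 (w ++ circle 0) (w' ++ circle 0).
Proof.
case/link_stepP => [/near_replace_circle //|/infinity_sz[u [v [[] [k [-> -> hu hv]]]]]].
have hv' : sz (v ++ circle 0) k.+1 = Some 0 by rewrite sz_cat hv.
rewrite -catA; apply: (near_trans (a := 0) (b := 0) (near_infinity hu hv')).
rewrite /swing map_cat -!catA.
pose x := Cup 0 tt :: map (shift 1) u ++ [:: Cap 0; Cup 0 tt] ++ map (shift 1) v.
have E (y : uword) : Cup 0 tt :: map (shift 1) u ++ [:: Cap 0; Cup 0 tt] ++
    map (shift 1) v ++ y = x ++ y by rewrite /x /= -catA.
have := sz_swing tt hu hv.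
rewrite /swing !E sz_cat.
case ex: (sz x 0) => [m|//] hx.
(* The swing has enclosed the circle under the new arc, so it now sits to the right of one
   strand. *)
apply: (circle_top (i := 1) ex hx).
by move: hx; rewrite /= /sz_event /=; case: ifP => //; lia.
Qed.

Lemma deform_circle k w w' : deform k w w' -> near k (w ++ circle 0) (w' ++ circle 0).
Proof.
elim=> [x|{}k x y z h _|{}k x y z h _].
- exact: near_refl.
- apply: (near_trans (a := 0)).
  by case: h => /near_step_circle // h; apply: near_sym.
- apply: (near_trans (a := 1)).
  exact/(@near_replace_circle true)/crossing_changeP.
Qed.

Lemma unlinks_circle w k : unlinks w k -> exists2 k', k' <= k & unlinks (w ++ circle 0) k'.
Proof.
case=> m /deform_circle[k' le h]; exists k' => //; exists m.+1.
suff -> : circles m.+1 = circles m ++ circle 0 by [].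
by rewrite /circles -[m.+1]addn1 nseqD flatten_cat.
Qed.

(** * Erasing components *)

Notation bword := (word bool).
Notation brun := (run (@id bool)).
Notation bstep := (apply_event (@id bool)).

Definition uncolor A (w : word A) : uword := map (map_event (fun _ => tt)) w.

Lemma sz_uncolor A (w : word A) k : sz (uncolor w) k = sz w k.
Proof. exact: sz_map. Qed.

(** Colours are decorations with the identity as [opp], hence constant along components. An event is
    renumbered by the kept strands to its left. Testing one end of a cap is enough, since a cap that
    fits joins equal colours. *)
Definition del_event (e : event bool) (s : seq bool) : uword :=
  match e with
  | Cup i a => if a then [:: Cup (count id (take i s)) tt] else [::]
  | Cap i => if nth false s i then [:: Cap (count id (take i s))] else [::]
  | Cross i b => if nth false s i && nth false s i.+1
                 then [:: Cross (count id (take i s)) b] else [::]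
  end.

(* Deletion of the strands coloured by false. *)
Fixpoint del (w : bword) (s : seq bool) : uword :=
  if w is e :: w' then
    del_event e s ++ (if bstep e s is Some s' then del w' s' else [::])
  else [::].

Lemma del_cat w1 w2 s s1 : brun w1 s = Some s1 ->
  del (w1 ++ w2) s = del w1 s ++ del w2 s1.
Proof.
elim: w1 s => /= [s [->] //|e w IH s].
by case: apply_event => //= t /IH ->; rewrite catA.
Qed.

Lemma del_event_shift p e s :
  del_event (shift (size p) e) (p ++ s) = map (shift (count id p)) (del_event e s).
Proof.
have K i : count id (take (size p + i) (p ++ s)) = count id p + count id (take i s).
  by rewrite take_cat ltnNge leq_addr /= addKn count_cat.
have N i : nth false (p ++ s) (size p + i) = nth false s i.
  by rewrite nth_cat ltnNge leq_addr /= addKn.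
by case: e => [i a|i|i b] /=; rewrite K -?addnS ?N; case: ifP.
Qed.

Lemma del_shift p w s :
  del (map (shift (size p)) w) (p ++ s) = map (shift (count id p)) (del w s).
Proof.
elim: w s => //= e w IH s; rewrite del_event_shift apply_event_shift map_cat.
by case: apply_event => //= t; rewrite IH.
Qed.

Lemma del_event_cat e s q : pos e + arity_in e <= size s ->
  del_event e (s ++ q) = del_event e s.
Proof.
have K i : i <= size s -> take i (s ++ q) = take i s.
  by move=> h; rewrite takel_cat.
have N i : i < size s -> nth false (s ++ q) i = nth false s i.
  by move=> h; rewrite nth_cat h.
by case: e => [i a|i|i b] /= h; rewrite K ?N; try lia.
Qed.

Lemma del_state_cat w s q m : sz w (size s) = Some m -> del w (s ++ q) = del w s.
Proof.
elim: w s => //= e w IH s.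
case E: sz_event => [k|] //= h; have le := sz_event_fit E.
rewrite (del_event_cat _ le) (apply_event_cat _ _ le).
case E': apply_event => [t|] //=; rewrite IH //.
by move: E; rewrite (size_apply_event E') => -[->].
Qed.

Lemma sz_del_event e s s' : bstep e s = Some s' ->
  sz (del_event e s) (count id s) = Some (count id s').
Proof.
move=> h; have le : pos e <= size s.
  by have := sz_event_fit (size_apply_event h); lia.
have [p [t [es sp]]] := split_size le.
have ee : e = shift (size p) (match e with Cup i a => Cup 0 a | Cap i => Cap 0
    | Cross i b => Cross 0 b end).
  by move: sp; case: (e) => /= *; rewrite addn0; f_equal.
move: h; rewrite ee es apply_event_shift del_event_shift.
set f := (X in omap _ (bstep X t)).
case E: apply_event => [t'|] //= [<-]; rewrite !count_cat.
apply: sz_shift; move: E; rewrite /f; case: (e) => [i a|i|i b] /=.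
- by rewrite ?drop0 ?take0 /= => -[<-]; case: a => //=; rewrite subn0 addn2.
- case: t {es} => [|x [|y t]] //=; case: eqP => //= -> [<-].
  by rewrite ?drop0; case: x => //=; rewrite subn2 addn0.
- case: t {es} => [|x [|y t]] //= [<-].
  by rewrite ?drop0; case: x; case: y => //=; sz_tac.
Qed.

Lemma sz_del w s s' : brun w s = Some s' -> sz (del w s) (count id s) = Some (count id s').
Proof.
elim: w s => /= [s [->] //|e w IH s].
by case E: apply_event => [t|] //= /IH; rewrite sz_cat (sz_del_event E).
Qed.

(** If all strands of the move are kept, it stays the same move. If one is erased, its crossings
    vanish on both sides and the remaining words coincide. *)
Lemma del_core_move c l r s s1 s2 : core_move c l r ->
  brun l s = Some s1 -> brun r s = Some s2 ->
  local_move c (del l s) (del r s) \/ del l s = del r s.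
Proof.
have L c' (l' r' : uword) : core_move c' l' r' -> local_move c' l' r'.
  move=> h; have := LocalCore 0 h.
  have E (w : uword) : map (shift 0) w = w by elim: w => //= -[i a|i|i b] w ->.
  by rewrite !E.
case=> [a|a|a b|b|a b|a b|b|b1 b2 b3 hb|b].
- case: s => [|x s] //=; rewrite drop0 take0 /=.
  by case: eqP => //= -> _ _; case: x; [left; apply/L; constructor|right].
- case: s => [|x s] //=.
  by case: eqP => //= -> _ _; case: a; [left; apply/L; constructor|right].
- case: s => [|x s] //=; rewrite ?drop0 ?take0 /= => _ _.
  by case: x; case: a; by [left; apply/L; constructor|right].
- case: s => [|x [|y [|z s]]] //=.
  case: eqP => //= -> _ _.
  by case: x; case: y; by [left; apply/L; constructor|right].
- case: s => [|x s] //=; rewrite ?drop0 ?take0 /=.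
  case: eqP => //= <- _ _.
  by case: a; by [left; apply/L; constructor|right].
- case: s => [|x s] //=; rewrite ?drop0 ?take0 /=.
  case: eqP => //= -> _ _.
  by case: a; by [left; apply/L; constructor|right].
- case: s => [|x [|y s]] //= _ _.
  by case: x; case: y; by [left; apply/L; constructor|right].
- case: s => [|x [|y [|z s]]] //= _ _.
  by case: x; case: y; case: z; by [left; apply/L; constructor|right].
- case: s => [|x [|y s]] //= _ _.
  by case: x; case: y; by [left; apply/L; constructor|right].
Qed.

(** For an exchange to survive erasing, the offset of the other event must still be the position
    plus the arity of this one. That holds because the block [p] ends exactly at the strands used by
    [e]. *)
Lemma del_event_shape e p p' : bstep e p = Some p' -> size p = pos e + arity_in e ->
  del_event e p = [::] /\ count id p = count id p' \/
  exists e', [/\ del_event e p = [:: e'], count id p = pos e' + arity_in e' &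
    count id p' = pos e' + arity_out e'].
Proof.
move=> h sp.
have C := sz_del_event h.
have ct j : j <= size p -> count id p = count id (take j p) + count id (drop j p).
  by move=> _; rewrite -count_cat cat_take_drop.
case: e h sp C => [i a|i|i b] /= h sp.
- case: a h => h /=; last by case=> ->; left.
  rewrite /sz_event /=; case: ifP => // le [<-]; right.
  exists (Cup (count id (take i p)) tt); split=> //=; rewrite take_oversize ?subn0; lia.
- have [x [y [t E]]] : exists x y t, drop i p = x :: y :: t by apply: drop_cons2; rewrite sp.
  have t0 : t = [::].
    by move: (congr1 size E); rewrite size_drop /=; case: t {E} => //= ? ?; lia.
  have := ct i; rewrite {1}sp leq_addr E t0 => /(_ isT) /= C1.
  have N : nth false p i = x by rewrite -[i]addn0 -nth_drop E.
  rewrite N; move: h; rewrite E; case: eqP => // exy _; rewrite exy in C1 *.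
  case: x exy C1 {N E} => exy C1; last by case=> ->; left.
  rewrite /= /sz_event /=; case: ifP => // le [<-]; right.
  exists (Cap (count id (take i p))); split=> //=; lia.
- have [x [y [t E]]] : exists x y t, drop i p = x :: y :: t by apply: drop_cons2; rewrite sp.
  have t0 : t = [::].
    by move: (congr1 size E); rewrite size_drop /=; case: t {E} => //= ? ?; lia.
  have := ct i; rewrite {1}sp leq_addr E t0 => /(_ isT) /= C1.
  have N : nth false p i = x by rewrite -[i]addn0 -nth_drop E.
  have N1 : nth false p i.+1 = y by rewrite -[i.+1]addn1 -nth_drop E.
  rewrite N N1; case: x C1 {N E} => C1; last by case=> ->; left.
  case: y C1 {N1} => C1; last by case=> ->; left.
  rewrite /= /sz_event /=; case: ifP => // le [<-]; right.
  exists (Cross (count id (take i p)) b); split=> //=; lia.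
Qed.

Lemma del_local_move c l r s s1 s2 : local_move c l r ->
  brun l s = Some s1 -> brun r s = Some s2 ->
  local_move c (del l s) (del r s) \/ del l s = del r s.
Proof.
case=> [e f|i {}c {}l {}r h] h1 h2; last first.
  have [p [t [es ei]]] := split_size (core_move_pos h h1 h2).
  move: h1 h2; rewrite es -ei !run_shift !del_shift.
  case E: run => [u|] //= _; case E': run => [u'|] //= _.
  have [H|->] := del_core_move h E E'; last by right.
  by left; apply: local_move_shift.
have [p [t [p' [t' [es sp hp ht _]]]]] := exchange_split (or_introl h1).
have [sp' _ _] := exchange_run sp hp ht.
have le : pos e + arity_in e <= size p by rewrite sp.
rewrite es /= (del_event_cat _ le) (apply_event_cat _ _ le) hp /= -sp -sp'.
rewrite !del_event_shift !apply_event_shift ht /= (del_event_cat _ le).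
rewrite !(apply_event_cat _ _ le) hp /= !cats0.
have [[-> ->]|[e' [-> -> ->]]] := del_event_shape hp sp; first by right; rewrite cats0.
(* Each event leaves at most one event, so the erased exchange is again an exchange or changes
   nothing. *)
have : size (del_event f t) <= 1 by case: (f) => * /=; case: ifP.
case: (del_event f t) => [|f' [|//]] _ /=; first by right.
by left; constructor.
Qed.

(** * Lifting deformations to coloured words *)

Ltac uncolor_inv :=
  repeat match goal with
  | H : uncolor ?L = [::] |- _ => destruct L; [clear H | discriminate H]
  | H : uncolor ?L = _ :: _ |- _ =>
      destruct L as [|[? ?|?|? ?] L]; try discriminate H;
      injection H as H; fold (uncolor L) in H; subst
  end.

Lemma bool_move_run c l r s s1 s2 : local_move c l r \/ local_move c r l ->
  brun l s = Some s1 -> brun r s = Some s2 -> s1 = s2.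
Proof.
have K : involutive (@id bool) by [].
by case=> h h1 h2; [apply: local_move_run K _ _ _ _ _ _ h h1 h2
  | apply/esym; apply: local_move_run K _ _ _ _ _ _ h h2 h1].
Qed.

(** Colours on the other side are inherited from [L], and a newly created minimum takes the colour
    of the strand on which it appears. Both directions of each move are treated, because an
    uncoloured deformation may use either. *)
Lemma core_move_lift c (l r : uword) (L : bword) s s' m :
  core_move c l r \/ core_move c r l -> uncolor L = l -> brun L s = Some s' ->
  sz r (size s) = Some m ->
  exists R s'', [/\ uncolor R = r, core_move c L R \/ core_move c R L &
                brun R s = Some s''].
Proof.
have P (R : bword) s'' : core_move c L R \/ core_move c R L -> brun R s = Some s'' ->
   uncolor R = r -> exists R' s'', [/\ uncolor R' = r,
     core_move c L R' \/ core_move c R' L & brun R' s = Some s''].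
  by move=> h1 h2 h3; exists R, s''.
case=> h eL hL hr;
  [case: c l r / h eL hr P => [a|a|a b|b|a b|a b|b|b1 b2 b3 hb|b] eL hr P
  |case: c r l / h eL hr P => [a|a|a b|b|a b|a b|b|b1 b2 b3 hb|b] eL hr P];
  uncolor_inv;
  move: hr hL; rewrite [sz _ _]/= /sz_event.
- by move=> _ _; apply: (P [::] s); [left; constructor|by []|by []].
- by move=> _ _; apply: (P [::] s); [left; constructor|by []|by []].
- case: s P => [|x s] P; first by [].
  by move=> _ _; eapply P; [left; eapply CoreCupSlide
    | rewrite /= ?take0 ?drop0 /=; reflexivity | reflexivity].
- case: s P => [|x [|y [|z s]]] //= P _; case: eqP => // e _.
  by eapply P; [left; eapply CoreCapSlide | rewrite /= e eqxx | reflexivity].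
- case: s P => [|x s] //= P _ _; case: a P => P.
  by apply: (P [:: Cup 1 x; Cross 0 b; Cap 1]);
    [left; constructor | rewrite /= ?take0 ?drop0 /= eqxx | reflexivity].
- case: s P => [|x s] //= P _ _; case: a P => P.
  by apply: (P [:: Cup 0 x; Cross 1 b; Cap 0]);
    [left; constructor | rewrite /= ?take0 ?drop0 /= eqxx | reflexivity].
- case: s P => [|x [|y s]] //= P _ _.
  by apply: (P [:: Cross 0 b; Cross 0 (~~ b)]);
    [left; constructor | rewrite /= ?take0 ?drop0 /=; reflexivity | reflexivity].
- case: s P => [|x [|y [|z s]]] //= P _ _.
  by eapply P; [left; eapply CoreRIII; exact hb
    | rewrite /= ?take0 ?drop0 /=; reflexivity | reflexivity].
- case: s P => [|x [|y s]] //= P _ _.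
  by eapply P; [left; eapply CoreFlip
    | rewrite /= ?take0 ?drop0 /=; reflexivity | reflexivity].
- case: s P => [|x s] //= P _ _; case: a P => P.
  by apply: (P [:: Cup 1 x; Cap 0]);
    [right; constructor | rewrite /= ?take0 ?drop0 /= eqxx | reflexivity].
- case: s P => [|x s] //= P _ _; case: a P => P.
  by apply: (P [:: Cup 0 x; Cap 1]);
    [right; constructor | rewrite /= ?take0 ?drop0 /= eqxx | reflexivity].
- case: s P => [|x s] P; first by [].
  by move=> _ _; eapply P; [right; eapply CoreCupSlide
    | rewrite /= ?take0 ?drop0 /=; reflexivity | reflexivity].
- case: s P => [|x [|y [|z s]]] //= P _; case: eqP => // e _.
  by eapply P; [right; eapply CoreCapSlide | rewrite /= e eqxx | reflexivity].
- by move=> _ _; apply: (P [::] s); [right; constructor|by []|by []].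
- by move=> _ _; apply: (P [::] s); [right; constructor|by []|by []].
- by move=> _ _; apply: (P [::] s); [right; constructor|by []|by []].
- case: s P => [|x [|y [|z s]]] //= P _ _.
  by eapply P; [right; eapply CoreRIII; exact hb
    | rewrite /= ?take0 ?drop0 /=; reflexivity | reflexivity].
- case: s P => [|x [|y s]] //= P _ _.
  by eapply P; [right; eapply CoreFlip
    | rewrite /= ?take0 ?drop0 /=; reflexivity | reflexivity].
Qed.

Lemma sz_shiftE A (w : word A) d k :
  sz (map (shift d) w) (d + k) = omap (addn d) (sz w k).
Proof.
elim: w k => [|e w IH] k //=.
rewrite {1}/sz_event pos_shift arity_in_shift arity_out_shift.
rewrite -addnA leq_add2l /sz_event; case: ifP => //= h; rewrite -IH.
by congr sz; lia.
Qed.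

Lemma uncolor_shift A (W : word A) d (w : uword) : uncolor W = map (shift d) w ->
  exists W0, W = map (shift d) W0 /\ uncolor W0 = w.
Proof.
elim: w W => [|e w IH] [|E W] //; first by exists [::].
move=> [eE /IH[W0 [-> <-]]].
have [E0 [-> <-]] : exists E0, E = shift d E0 /\ map_event (fun _ => tt) E0 = e.
  case: e E eE => [i []|i|i b] [j a|j|j c] //= []; [move=> ->|move=> ->|move=> -> ->].
  + by exists (Cup i a).
  + by exists (Cap i).
  + by exists (Cross i b).
by exists (E0 :: W0).
Qed.

Lemma uncolor_cat A (W : word A) w1 w2 : uncolor W = w1 ++ w2 ->
  exists W1 W2, [/\ W = W1 ++ W2, uncolor W1 = w1 & uncolor W2 = w2].
Proof.
move=> h; exists (take (size w1) W), (drop (size w1) W).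
by rewrite cat_take_drop /uncolor map_take map_drop -/(uncolor W) h take_size_cat ?drop_size_cat.
Qed.

Lemma map_event_pos A B (f : A -> B) e : pos (map_event f e) = pos e.
Proof. by case: e. Qed.
Lemma map_event_in A B (f : A -> B) e : arity_in (map_event f e) = arity_in e.
Proof. by case: e. Qed.
Lemma map_event_out A B (f : A -> B) e : arity_out (map_event f e) = arity_out e.
Proof. by case: e. Qed.

Lemma exchange_lift_up (e f : event unit) (L : bword) s s' :
  uncolor L = [:: e; shift (pos e + arity_out e) f] -> brun L s = Some s' ->
  exists R, [/\ uncolor R = [:: shift (pos e + arity_in e) f; e],
                local_move false L R & brun R s = Some s'].
Proof.
move=> h hL.
have [L1 [L2 [eL h1 h2]]] := @uncolor_cat _ L [:: e] _ h.
have [L0 [eL2 e2]] := @uncolor_shift _ L2 (pos e + arity_out e) [:: f] h2.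
case: L1 h1 eL => [|E [|//]] //= [eE]; rewrite eL2 {L2 h2 eL2}.
case: L0 e2 => [|F [|//]] //= [eF] eL.
rewrite -eE map_event_pos map_event_out in eL; rewrite eL in hL *.
have [p [t [p' [t' [es sp hp ht es']]]]] := exchange_split (or_introl hL).
have [_ _ r2] := exchange_run sp hp ht.
exists [:: shift (pos E + arity_in E) F; E]; split; last by rewrite es es'.
  by rewrite /uncolor /= map_event_shift eF eE -eE map_event_pos map_event_in.
by constructor.
Qed.

Lemma exchange_lift_down (e f : event unit) (L : bword) s s' :
  uncolor L = [:: shift (pos e + arity_in e) f; e] -> brun L s = Some s' ->
  exists R, [/\ uncolor R = [:: e; shift (pos e + arity_out e) f],
                local_move false R L & brun R s = Some s'].
Proof.
move=> h hL.
have [L1 [L2 [eL h1 h2]]] := @uncolor_cat _ L [:: shift (pos e + arity_in e) f] _ h.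
have [L0 [eL2 e2]] := @uncolor_shift _ L1 (pos e + arity_in e) [:: f] h1.
case: L2 h2 eL => [|E [|//]] //= [eE]; rewrite eL2 {L1 h1 eL2}.
case: L0 e2 => [|F [|//]] //= [eF] eL.
rewrite -eE map_event_pos map_event_in in eL; rewrite eL in hL *.
have [p [t [p' [t' [es sp hp ht es']]]]] := exchange_split (or_intror hL).
have [_ r1 _] := exchange_run sp hp ht.
exists [:: E; shift (pos E + arity_out E) F]; split; last by rewrite es es'.
  by rewrite /uncolor /= map_event_shift eF eE -eE map_event_pos map_event_out.
by constructor.
Qed.

Lemma local_move_lift c (l r : uword) (L : bword) s s' m :
  local_move c l r \/ local_move c r l -> uncolor L = l -> brun L s = Some s' ->
  sz r (size s) = Some m ->
  exists R, [/\ uncolor R = r, local_move c L R \/ local_move c R L & brun R s = Some s'].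
Proof.
move=> h eL hL hr.
have hl : sz l (size s) = Some (size s') by rewrite -eL sz_uncolor (size_run hL).
have Y i (l0 r0 : uword) : core_move c l0 r0 \/ core_move c r0 l0 ->
    l = map (shift i) l0 -> r = map (shift i) r0 ->
    exists R, [/\ uncolor R = r, local_move c L R \/ local_move c R L & brun R s = Some s'].
  move=> h' el er.
  have le : i <= size s.
    have := @core_move_pos _ uopp c; rewrite -(size_nseq (size s) tt) => P.
    case: h' => h'; apply: (P _ _ _ _ _ _ h'); rewrite -?el -?er urun size_nseq ?hl ?hr //.
  have [p [t [es ei]]] := split_size le.
  have [L0 [eL0 eL1]] := uncolor_shift (etrans eL el).
  move: hL hr; rewrite es eL0 er -ei run_shift size_cat sz_shiftE.
  case hL: (brun L0 t) => [t'|] //= [<-]; case hr: sz => [m'|] //= _.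
  have [R [t'' [eR hR hR2]]] := core_move_lift h' eL1 hL hr.
  have hLR : local_move c (map (shift (size p)) L0) (map (shift (size p)) R) \/
     local_move c (map (shift (size p)) R) (map (shift (size p)) L0).
    by case: hR => hR; [left|right]; constructor.
  exists (map (shift (size p)) R); split=> //.
    by rewrite -eR /uncolor map_map_shift.
  rewrite run_shift hR2 /=; congr Some.
  (* Once both sides are coloured and fit, the colours above them agree, so the colouring of the
     rest of the diagram can stay. *)
  apply/esym; apply: (bool_move_run (s := p ++ t) hLR); rewrite run_shift ?hL ?hR2 //.
case: h => h.
- case: c l r / h eL hL hr hl Y => [e f|i c l r h] eL hL hr hl Y.
  + by have [R [? ? ?]] := exchange_lift_up eL hL; exists R; split=> //; left.
  + by apply: (Y i l r) => //; left.
- case: c r l / h eL hL hr hl Y => [e f|i c r l h] eL hL hr hl Y.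
  + by have [R [? ? ?]] := exchange_lift_down eL hL; exists R; split=> //; right.
  + by apply: (Y i l r) => //; right.
Qed.

(** The last clause is the purpose: the erased diagrams follow the deformation without needing more
    crossing changes. *)
Definition lifts d (W : bword) (w' : uword) := exists W' : bword,
  [/\ uncolor W' = w', is_diagram id W' & near d (del W [::]) (del W' [::])].

Lemma diagram_cat (A : eqType) (opp : A -> A) u l v : is_diagram opp (u ++ l ++ v) ->
  exists s s', [/\ run opp u [::] = Some s, run opp l s = Some s' & run opp v s' = Some [::]].
Proof.
rewrite /is_diagram !run_cat; case: (run opp u _) => [s|] //=; rewrite run_cat.
by case E: run => [s'|] //= h; exists s, s'.
Qed.

Lemma cat_diagram (A : eqType) (opp : A -> A) u l v s s' :
  run opp u [::] = Some s -> run opp l s = Some s' -> run opp v s' = Some [::] ->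
  is_diagram opp (u ++ l ++ v).
Proof. by move=> h1 h2 h3; rewrite /is_diagram run_cat h1 /= run_cat h2. Qed.

Lemma lift_local c u v (l r : uword) (W : bword) :
  local_move c l r \/ local_move c r l -> sz (u ++ r ++ v) 0 = Some 0 ->
  uncolor W = u ++ l ++ v -> is_diagram id W -> lifts c W (u ++ r ++ v).
Proof.
move=> h hr /uncolor_cat[U [W1 [-> eU /uncolor_cat[L [V [-> eL eV]]]]]].
move=> /diagram_cat[s [s' [hU hL hV]]].
have [m hm] : exists m, sz r (size s) = Some m.
  move: hr; rewrite sz_cat -eU sz_uncolor (size_run hU) /= sz_cat.
  by case: (sz r) => [m|] // _; exists m.
have [R [eR hR hR2]] := local_move_lift h eL hL hm.
exists (U ++ R ++ V); split.
- by rewrite /uncolor !map_cat -/(uncolor _) eU -!/(uncolor _) eR eV.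
- exact: cat_diagram hU hR2 hV.
rewrite !(del_cat _ hU) (del_cat _ hL) (del_cat _ hR2).
have zU := sz_del hU; have zL := sz_del hL; have zR := sz_del hR2.
have zV := sz_del hV; rewrite /= in zU zV.
have z1 : sz (del U [::] ++ del L s ++ del V s') 0 = Some 0.
  by rewrite sz_cat zU /= sz_cat zL.
have z2 : sz (del U [::] ++ del R s ++ del V s') 0 = Some 0.
  by rewrite sz_cat zU /= sz_cat zR.
case: hR => hR.
- have [H|->] := del_local_move hR hL hR2; last exact: near_refl.
  exact: near_local.
- have [H|->] := del_local_move hR hR2 hL; last exact: near_refl.
  exact/near_sym/near_local.
Qed.

(** The new arc has the colour [x] of the swung strand. If that colour is erased, the diagram after
    erasing is unchanged; otherwise the erased diagrams differ by a swing. As a number, [x] is the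
    shift caused by the outer arc. *)
Lemma del_swing x U V s : brun U [::] = Some (x :: s) -> brun V (x :: s) = Some [::] ->
  is_diagram id (swing x U V) /\ near 0 (del (U ++ V) [::]) (del (swing x U V) [::]).
Proof.
move=> hU hV.
have zU := size_run hU; have zV := size_run hV; rewrite /= in zU zV.
have r1 : brun (map (shift 1) U) [:: x; x] = Some (x :: x :: rcons s x).
  have := run_frame id [:: x] [:: x] (s := [::]) zU.
  by rewrite hU /= -cats1.
have r2 : brun (map (shift 1) V) (x :: x :: rcons s x) = Some [:: x; x].
  have := run_frame id [:: x] [:: x] (s := x :: s) zV.
  by rewrite hV /= -cats1.
have d1 : del (map (shift 1) U) [:: x; x] = map (shift x) (del U [::]).
  have := del_shift [:: x] U [:: x]; rewrite /= addn0 => ->.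
  by rewrite (del_state_cat (s := [::]) [:: x] zU).
have d2 : del (map (shift 1) V) (x :: x :: rcons s x) = map (shift x) (del V (x :: s)).
  have := del_shift [:: x] V (x :: rcons s x); rewrite /= addn0 => ->.
  by rewrite -rcons_cons -cats1 (del_state_cat (s := x :: s) [:: x] zV).
split.
  rewrite /is_diagram /swing /= run_cat r1 /= eqxx /= run_cat take0 drop0 r2 /=.
  by rewrite eqxx.
have eq : del (swing x U V) [::] =
    (if x then [:: Cup 0 tt] else [::]) ++ map (shift x) (del U [::]) ++
    (if x then [:: Cap 0; Cup 0 tt] else [::]) ++ map (shift x) (del V (x :: s)) ++
    (if x then [:: Cap 0] else [::]).
  rewrite /swing /= (del_cat _ r1) d1 /= eqxx take0 drop0 (del_cat _ r2) d2 /= eqxx cats0.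
  by case: (x).
have zdU := sz_del hU; have zdV := sz_del hV.
rewrite eq (del_cat _ hU).
case: x {hU hV r1 r2 d1 d2 eq} zdU zdV => /= zdU zdV; last first.
  have E (w : uword) : map (shift 0) w = w by elim: w => //= -[i a|i|i b] w ->.
  by rewrite !E cats0; apply: near_refl.
rewrite add1n in zdU zdV; exact: near_infinity zdU zdV.
Qed.

Lemma lift_infinity u v k (W : bword) : sz u 0 = Some k.+1 -> sz v k.+1 = Some 0 ->
  uncolor W = u ++ v -> is_diagram id W -> lifts 0 W (swing tt u v).
Proof.
move=> hu hv /uncolor_cat[U [V [-> eU eV]]] h.
have [s [s' [hU /= [<-] hV]]] := diagram_cat (l := [::]) h.
case: s hU hV => [|x s] hU hV.
  by move: hu; rewrite -eU sz_uncolor (size_run hU).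
have [h1 h2] := del_swing hU hV.
exists (swing x U V); split=> //.
rewrite /swing /uncolor /= map_cat /= map_cat /= !map_map_shift.
by rewrite -!/(uncolor _) eU eV.
Qed.

Lemma lift_infinity_sym u v k (W : bword) : sz u 0 = Some k.+1 -> sz v k.+1 = Some 0 ->
  uncolor W = swing tt u v -> is_diagram id W -> lifts 0 W (u ++ v).
Proof.
move=> hu hv e.
have [W1 [W2 [-> eW1 eW2]]] := @uncolor_cat _ W [:: Cup 0 tt] _ e.
have [W3 [W4 [-> eW3 eW4]]] := uncolor_cat eW2.
have [W5 [W6 [-> eW5 eW6]]] := @uncolor_cat _ W4 [:: Cap 0; Cup 0 tt] _ eW4.
have [W7 [W8 [-> eW7 eW8]]] := uncolor_cat eW6.
have [U [-> eU]] := uncolor_shift eW3; have [V [-> eV]] := uncolor_shift eW7.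
have [a ->] : exists a, W1 = [:: Cup 0 a].
  by case: W1 eW1 {e} => [|[i a|i|i b] [|//]] //= [->]; exists a.
have [a' ->] : exists a, W5 = [:: Cap 0; Cup 0 a].
  by case: W5 eW5 {eW6 eW4} => [|[i ?|i|i b] [|[j a2|j|j b2] [|//]]] //= [-> ->]; exists a2.
have -> : W8 = [:: Cap 0].
  by case: W8 eW8 {eW6} => [|[i ?|i|i b] [|//]] //= [->].
have zU : sz U (size (Nil bool)) = Some k.+1 by rewrite -sz_uncolor eU.
rewrite /is_diagram /= run_cat.
rewrite (run_frame id [:: a] [:: a] zU).
case hU: run => [[|x s]|] //=.
  by move: (size_run hU); rewrite -sz_uncolor eU hu.
(* The middle cap forces the swung strand to have the colour of the first cup; the final cap,
   reached further on, identifies the colours of the two cups. *)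
case: eqP => //= exa; rewrite take0 drop0.
rewrite run_cat -cat_cons -[a' :: _]/([:: a'] ++ _).
have zV : sz V (size (a' :: s)) = Some 0.
  by rewrite /= -sz_uncolor eV; move: (size_run hU); rewrite -sz_uncolor eU hu => -[<-].
rewrite -[X in [:: a'] ++ X]/((a' :: s) ++ [:: a]) (run_frame id [:: a'] [:: a] zV).
case hV: run => [[|y t]|] //=; last first.
  by move: (size_run hV); rewrite zV.
case: eqP => //= ea _; rewrite -ea in hV; rewrite exa in hU.
have [h1 h2] := del_swing hU hV.
exists (U ++ V); split.
- by rewrite /uncolor map_cat -/(uncolor _) eU -/(uncolor _) eV.
- by rewrite /is_diagram run_cat hU.
apply: near_sym; move: h2; rewrite /swing -ea. exact: id.
Qed.

Lemma deform_lift k w w' : deform k w w' -> forall W, uncolor W = w ->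
  is_diagram id W -> lifts k W w'.
Proof.
have L d k' (W : bword) (x y : uword) : lifts d W x ->
    (forall W, uncolor W = x -> is_diagram id W -> lifts k' W y) -> lifts (d + k') W y.
  case=> W' [e h n] /(_ _ e h)[W'' [e' h' n']].
  by exists W''; split=> //; apply: near_trans n n'.
elim=> [x W e h|{}k x y z h _ IH W e hW|{}k x y z h _ IH W e hW].
- by exists W; split=> //; apply: near_refl.
- apply: (L 0 k W y z) IH.
  case: h e => /link_stepP[[u v l r h h1 h2] e|/infinity_sz[u [v [[] [j [-> -> hu hv]]]]] e].
  + exact: (@lift_local false u v l r W (or_introl h) (diagram_sz h2) e hW).
  + exact: lift_infinity hu hv e hW.
  + exact: (@lift_local false u v r l W (or_intror h) (diagram_sz h1) e hW).
  + exact: lift_infinity_sym hu hv e hW.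
- rewrite -add1n; apply: (L 1 k W y z) IH.
  case: {h} (crossing_changeP h) e => u v l r h h1 h2 e.
  exact: (@lift_local true u v l r W (or_introl h) (diagram_sz h2) e hW).
Qed.

(** Each circle has a single colour and is kept or erased as a whole, so erasing sends a standard
    trivial diagram to a standard trivial diagram. *)
Lemma del_circles m (W : bword) : uncolor W = circles m -> is_diagram id W ->
  exists m', del W [::] = circles m'.
Proof.
elim: m W => [|m IH] W; first by case: W => // _ _; exists 0.
move=> /(@uncolor_cat _ W (circle 0))[W1 [W2 [-> e1 e2]]].
case: W1 e1 => [|[i a|i|i b] [|[j a2|j|j b2] [|//]]] //= [-> ->].
by case: a; rewrite /is_diagram /= => /(IH _ e2)[m' ->]; [exists m'.+1|exists m'].
Qed.

Lemma del_const_true (w : uword) k m : sz w k = Some m ->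
  brun (map (map_event (fun _ => true)) w) (nseq k true) = Some (nseq m true) /\
  del (map (map_event (fun _ => true)) w) (nseq k true) = w.
Proof.
have Ct i k' : i <= k' -> count id (take i (nseq k' true)) = i.
  by move=> h; rewrite take_nseq // count_nseq mul1n.
elim: w k => [|e w IH] k; first by case=> ->.
rewrite [sz _ _]/=; case E: sz_event => [k'|] //= /IH[hr hd].
have [-> ->] : bstep (map_event (fun _ => true) e) (nseq k true) = Some (nseq k' true) /\
  del_event (map_event (fun _ => true) e) (nseq k true) = [:: e].
  move: E; rewrite /sz_event; case: ifP => // le [<-].
  have D i j : i + j <= k -> drop i (nseq k true) = nseq j true ++ nseq (k - i - j) true.
    by move=> h; rewrite drop_nseq -nseqD; congr nseq; lia.
  have T i : i <= k -> take i (nseq k true) = nseq i true.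
    by move=> h; rewrite take_nseq.
  case: e le => [i []|i|i b] /= le.
  - rewrite size_nseq Ct; last lia.
    rewrite (_ : (i <= k)) /=; last by lia.
    split=> //; congr Some; rewrite T ?drop_nseq; last lia.
    by rewrite -[true :: true :: _]/(nseq 2 true ++ _) -!nseqD; congr nseq; lia.
  - rewrite (D i 2) //= Ct ?nth_nseq; last lia.
    rewrite (_ : (i < k)) /=; last by lia.
    split=> //; congr Some; rewrite T; last lia.
    by rewrite -!nseqD; congr nseq; lia.
  - rewrite (D i 2) //= Ct ?nth_nseq; last lia.
    rewrite (_ : (i < k)) /=; last by lia.
    rewrite (_ : (i.+1 < k)) /=; last by lia.
    split=> //; congr Some; rewrite T; last lia.
    by rewrite -[true :: true :: _]/(nseq 2 true ++ _) -!nseqD; congr nseq; lia.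
by rewrite /= hr hd.
Qed.

(** Colour the circle with [false] and everything else with [true]. The lifted unlinking sequence
    then erases to one that starts at [u ++ v] and ends at a trivial diagram. *)
Lemma unlinks_uncircle u v i k j : sz u 0 = Some k -> sz v k = Some 0 -> i <= k ->
  unlinks (u ++ circle i ++ v) j -> exists2 j', j' <= j & unlinks (u ++ v) j'.
Proof.
move=> hu hv le [m h].
pose c (w : uword) := map (map_event (fun _ => true)) w : bword.
pose W : bword := c u ++ [:: Cup i false; Cap i] ++ c v.
have [ru du] := del_const_true hu; have [rv dv] := del_const_true hv.
have cK w : uncolor (c w) = w.
  by rewrite /c /uncolor; elim: w => //= -[? []|?|? ?] w ->.
have rc : brun [:: Cup i false; Cap i] (nseq k true) = Some (nseq k true).
  rewrite /= size_nseq le /= drop_size_cat ?size_takel ?size_nseq //= take_size_cat.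
    by rewrite cat_take_drop.
  by rewrite size_takel ?size_nseq.
have eW : uncolor W = u ++ circle i ++ v.
  by rewrite /W /uncolor !map_cat -!/(uncolor _) !cK.
have [|W' [eW' hW' [j' le' n]]] := deform_lift h eW.
  exact: cat_diagram ru rc rv.
have [m' em] := del_circles eW' hW'.
exists j' => //; exists m'; rewrite -em.
suff <- : del W [::] = u ++ v by [].
rewrite /W (del_cat _ ru) (del_cat _ rc) du dv /=.
rewrite size_nseq le drop_size_cat ?size_takel ?size_nseq //=.
rewrite nth_cat size_takel ?size_nseq // ltnn subnn /=.
by [].
Qed.

Lemma link_u_circle u v i k : sz u 0 = Some k -> sz v k = Some 0 -> i <= k ->
  link_u (u ++ circle i ++ v) = link_u (u ++ v).
Proof.
move=> hu hv le.
have n := circle_top hu hv le.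
have [] := @link_u_close 0 (u ++ v) (u ++ circle i ++ v); last by lia.
  move=> j /unlinks_circle[j1 le1 /(near_unlinks n)[j2 le2 h2]].
  by exists j2 => //; lia.
by move=> j /(unlinks_uncircle hu hv le)[j' le' h]; exists j'; first lia.
Qed.

(** * The sum over the crossings *)

Local Open Scope ring_scope.

Lemma oppK_ostrand n : involutive (@oopp n).
Proof. by case=> c o; rewrite /oopp /= negbK. Qed.

Section Sum.
Variables (n : nat) (S T : 'M[int]_n).
Implicit Types (e : event (ostrand n)) (s p q : seq (ostrand n)) (w : oword n).
Implicit Types (g : uword -> int).
Notation orun := (run (@oopp n)).
Notation ostep := (apply_event (@oopp n)).

(* The term of a crossing in [iu], where gv and gh are the distances from the
   unknotting numbers of its vertical and horizontal smoothings to that of the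
   link. *)
Definition weight (b : bool) (x y : ostrand n) (gv gh : int) : int :=
  T x.1 y.1 * ((if b then 1 else -1) * (if x.2 == y.2 then 1 else -1)) *
  (if S x.1 y.1 == 1 then (if x.2 == y.2 then gv else gh)
   else if S x.1 y.1 == -1 then (if x.2 == y.2 then gh else gv) else 0).

Definition crossing_in e s : option (bool * ostrand n * ostrand n) :=
  if e is Cross i b then
    if drop i s is x :: y :: _ then Some (b, x, y) else None
  else None.

Definition contrib g e s : int :=
  if crossing_in e s is Some (b, x, y) then
    weight b x y (g [::]) (g [:: Cap (pos e); Cup (pos e) tt])
  else 0.

(* The part of [iu] due to the crossings in a subword w of a diagram, where s
   is the state below w, and g m is the deviation of the unknotting number when
   w is replaced with m. *)
Fixpoint csum g w s : int :=
  if w is e :: w' then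
    contrib (fun m => g (m ++ forget w')) e s +
    (if ostep e s is Some s' then csum (fun m => g (forget [:: e] ++ m)) w' s' else 0)
  else 0.

Definition term g (D : oword n) (k : nat) : int :=
  if crossing_at D k is Some (b, x, y) then
    weight b x y (g (smooth true (forget D) k)) (g (smooth false (forget D) k))
  else 0.

Definition deviation (D : oword n) (m : uword) : int :=
  `|(link_u m)%:Z - (link_u (forget D))%:Z|.

(** A crossing belongs to at most one of the two sums. Its regular smoothing is vertical for
    parallel strands and horizontal otherwise, which is the choice built into [weight]. *)
Lemma iu_term D : iu S T D = \sum_(k < size D) term (deviation D) D k.
Proof.
rewrite /iu [X in X + _]big_mkcond [X in _ + X]big_mkcond -big_split /=.
apply: eq_bigr => k _.
rewrite /term /entry /sign /regular_smoothing /irregular_smoothing /parallel.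
case: crossing_at => [[[b x] y]|]; last by rewrite addr0.
rewrite /weight -/(deviation D _).
case: eqVneq => [->|_].
  by rewrite addr0; case: (x.2 == y.2).
case: eqVneq => _; last by rewrite mulr0 addr0.
by rewrite add0r; case: (x.2 == y.2).
Qed.

Lemma term_csum g u w s s' : orun u [::] = Some s -> orun w s = Some s' ->
  \sum_(k < size w) term g (u ++ w) (size u + k) = csum (fun m => g (forget u ++ m)) w s.
Proof.
elim: w u s => [|e w IH] u s hu /=; first by rewrite big_ord0.
case he: apply_event => [t|] //= hw.
rewrite big_ord_recl /= addn0; congr (_ + _).
  rewrite /term /contrib /crossing_at onth_cat ltnn subnn /= take_size_cat // hu.
  rewrite /crossing_in; case: e {he} => [i a|i|i b] //.
  case: drop => [|x [|y q]] //; congr weight; congr g;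
    rewrite /smooth /forget map_cat onth_cat size_map ltnn subnn /=;
    by rewrite take_size_cat ?drop_cat ?size_map // ltnNge leqnSn /= subSnn /= drop0.
have hu' : orun (u ++ [:: e]) [::] = Some t by rewrite run_cat hu /= he.
transitivity (csum (fun m => g (forget (u ++ [:: e]) ++ m)) w t); last first.
  by rewrite /forget map_cat; congr csum; apply: funext => m; rewrite -catA.
rewrite -(IH _ _ hu' hw) size_cat /= addn1 -catA /=.
by apply: eq_bigr => k _; rewrite /bump leq0n add1n addSnnS.
Qed.

Lemma iu_csum D : is_diagram (@oopp n) D -> iu S T D = csum (deviation D) D [::].
Proof.
move=> hD; rewrite iu_term.
exact: (@term_csum (deviation D) [::] D [::] [::] erefl hD).
Qed.

Lemma contrib_shift g p e s :
  contrib g (shift (size p) e) (p ++ s) =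
  contrib (fun m => g (map (shift (size p)) m)) e s.
Proof.
rewrite /contrib /crossing_in; case: e => [i a|i|i b] //=.
by rewrite drop_cat ltnNge leq_addr /= addKn.
Qed.

Lemma contrib_cat g e s q : (pos e + arity_in e <= size s)%N ->
  contrib g e (s ++ q) = contrib g e s.
Proof.
rewrite /contrib /crossing_in; case: e => [i a|i|i b] //= h.
have [x [y [s' E]]] := drop_cons2 h.
by rewrite drop_cat E (_ : (i < size s)%N) //=; lia.
Qed.

Lemma csum_cat g w1 w2 s s1 : orun w1 s = Some s1 ->
  csum g (w1 ++ w2) s =
  csum (fun m => g (m ++ forget w2)) w1 s + csum (fun m => g (forget w1 ++ m)) w2 s1.
Proof.
elim: w1 g s => [|e w1 IH] g s /=; first by case=> ->; rewrite add0r.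
case he: apply_event => [t|] //= /IH ->; rewrite addrA; congr (_ + _ + _).
by congr contrib; apply: funext => m; rewrite /forget map_cat catA.
Qed.

(** Both smoothings of a crossing keep the number of strands, so [g] is evaluated only on words that
    fit. This restriction matters because moves relate unknotting numbers of diagrams only. *)
Lemma csum_ext (g g' : uword -> int) w s s' m0 : orun w s = Some s' ->
  sz w (size s) = Some m0 ->
  (forall m, sz m (size s) = Some m0 -> g m = g' m) -> csum g w s = csum g' w s.
Proof.
elim: w g g' s => [|e w IH] g g' s //=.
case he: apply_event => [t|] //= hw; rewrite (size_apply_event he) /= => hz hg.
congr (_ + _); last first.
  apply: IH hw hz _ => m hm; apply: hg.
  have := size_apply_event he; rewrite /= => he'.
  have -> : sz_event (map_event (fun=> tt) e) (size s) = sz_event e (size s) by case: (e).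
  by rewrite he'.
have zw k : sz (forget w) k = sz w k by apply: sz_map.
case: e he => [i a|i|i b] // he; rewrite /contrib /crossing_in.
have := size_apply_event he => he'; have := sz_event_fit he' => /= le.
have est : size t = size s by move: he'; rewrite /sz_event /= le => -[]; lia.
case: drop => [|x [|y q]] //; congr weight; apply: hg => /=.
  by rewrite zw -est.
rewrite (_ : sz_event (Cap i) (size s) = Some (size s - 2)%N); last first.
  by rewrite /sz_event /= le addn0.
rewrite /= (_ : sz_event (Cup i tt) (size s - 2) = Some (size t)) /= ?zw //.
by rewrite est /sz_event /=; move: (size s) le => k le; rewrite ifT; [congr Some; lia | lia].
Qed.

Lemma csum_shift g p w s :
  csum g (map (shift (size p)) w) (p ++ s) =
  csum (fun m => g (map (shift (size p)) m)) w s.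
Proof.
elim: w g s => //= e w IH g s; rewrite contrib_shift apply_event_shift.
congr (_ + _).
  congr contrib; apply: funext => m.
  by rewrite map_cat /forget map_map_shift.
case: apply_event => //= t; rewrite IH; congr csum; apply: funext => m.
by rewrite map_event_shift.
Qed.

Lemma csum_state_cat g w s q m : sz w (size s) = Some m ->
  csum g w (s ++ q) = csum g w s.
Proof.
elim: w g s => //= e w IH g s.
case E: sz_event => [k|] //= h; have le := sz_event_fit E.
rewrite (contrib_cat _ _ le) (apply_event_cat _ _ le).
case E': apply_event => [t|] //=; rewrite IH //.
by move: E; rewrite (size_apply_event E') => -[->].
Qed.

End Sum.

(** * Stability of weights and exchange of distant crossings *)

Lemma sz_event_in A (e : event A) j :
  sz_event e (pos e + arity_in e + j) = Some (pos e + arity_out e + j)%N.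
Proof. by rewrite /sz_event leq_addr; congr Some; lia. Qed.

Lemma nearby_slide (e : event unit) (w : uword) j m : sz w j = Some m ->
  nearby 0 (pos e + arity_in e + j) (e :: map (shift (pos e + arity_out e)) w)
    (map (shift (pos e + arity_in e)) w ++ [:: e]).
Proof.
elim: w j => [|f w IH] j.
  by move=> _; apply: (@nearby_refl _ _ _ (pos e + arity_out e + j)); rewrite /= sz_event_in.
rewrite [sz _ _]/=; case E: sz_event => [j'|] //= h.
have f1 d : sz [:: shift d f] (d + j) = Some (d + j')%N by rewrite (sz_shiftE [:: f]) /= E.
have z1 : sz [:: e; shift (pos e + arity_out e) f] (pos e + arity_in e + j)
    = Some (pos e + arity_out e + j')%N.
  by rewrite -cat1s sz_cat [sz [:: e] _]/= sz_event_in [obind _ _]f1.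
have z2 : sz [:: shift (pos e + arity_in e) f; e] (pos e + arity_in e + j)
    = Some (pos e + arity_out e + j')%N.
  by rewrite -cat1s sz_cat f1 /= sz_event_in.
have zw d : sz (map (shift d) w) (d + j') = Some (d + m)%N by rewrite sz_shiftE h.
apply: (nearby_trans (a := 0) (b := 0)
  (w2 := shift (pos e + arity_in e) f :: e :: map (shift (pos e + arity_out e)) w)).
  apply: (nearby_catr (m := (pos e + arity_out e + m)%N) (nearby_exchange z1 z2)).
  by rewrite sz_cat z1 /= zw.
exact: (nearby_catl (f1 _) (IH _ h)).
Qed.

Lemma nearby_smoothing_slide i (f : event unit) k j j' : k = (i + 2 + j)%N ->
  sz_event f j = Some j' ->
  nearby 0 k [:: Cap i; Cup i tt; shift (i + 2) f] [:: shift (i + 2) f; Cap i; Cup i tt].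
Proof.
move=> -> hf.
have fd d : sz [:: shift d f] (d + j) = Some (d + j')%N by rewrite (sz_shiftE [:: f]) /= hf.
have s1 : nearby 0 (i + j) [:: Cup i tt; shift (i + 2) f] [:: shift i f; Cup i tt].
  have := @nearby_slide (Cup i tt) [:: f] j j'; rewrite /= addn0 hf; exact.
have s2 : nearby 0 (i + 2 + j) [:: Cap i; shift i f] [:: shift (i + 2) f; Cap i].
  have := @nearby_slide (Cap i) [:: f] j j'; rewrite /= addn0 hf; exact.
have c1 a : sz [:: Cap i] (i + 2 + a) = Some (i + a)%N by sz_tac.
have c2 a : sz [:: Cup i tt] (i + a) = Some (i + 2 + a)%N by sz_tac.
apply: (nearby_trans (a := 0) (b := 0) (w2 := [:: Cap i; shift i f; Cup i tt])).
  exact: (nearby_catl (c1 unit j) s1).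
apply: (nearby_catr (m := (i + 2 + j')%N) s2).
have -> := sz_cat [:: Cap i] [:: shift i f; Cup i tt] (i + 2 + j).
rewrite c1; have /= -> := sz_cat [:: shift i f] [:: Cup i tt] (i + j).
by have /= -> := fd i; rewrite [obind _ _]c2.
Qed.

Section Local.
Variables (n : nat) (S T : 'M[int]_n).
Hypotheses (Ssym : S^T = S) (Tsym : T^T = T).
Hypothesis T1 : forall i j, T i j \in [:: -1; 0; 1].
Implicit Types (e : event (ostrand n)) (s p q t : seq (ostrand n)) (w : oword n).
Notation orun := (run (@oopp n)).
Notation ostep := (apply_event (@oopp n)).
Notation weight := (weight S T).
Notation contrib := (contrib S T).
Notation csum := (csum S T).

Lemma symE (M : 'M[int]_n) i j : M^T = M -> M i j = M j i.
Proof. by move=> {1}<-; rewrite mxE. Qed.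

(** At the second crossing of a bigon the strands have changed sides while the same one is above, so
    [b] changes and the sign is opposite. *)
Lemma weight_swap b (x y : ostrand n) gv gh :
  weight (~~ b) y x gv gh = - weight b x y gv gh.
Proof.
rewrite /weight (symE y.1 x.1 Ssym) (symE y.1 x.1 Tsym) (eq_sym y.2) -mulNr -mulrN.
by congr (_ * _ * _); case: b; rewrite /= ?mul1r ?mulN1r ?opprK.
Qed.

(** This is the effect of turning a crossing by a quarter turn: one strand is read in the opposite
    direction, [b] changes, and vertical and horizontal smoothings trade places. Sign and regularity
    of a smoothing do not depend on the height function. *)
Lemma weight_reverse b (x y : ostrand n) gv gh :
  weight (~~ b) y (oopp x) gh gv = weight b x y gv gh.
Proof.
rewrite /weight (symE y.1 _ Ssym) (symE y.1 _ Tsym) /=.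
have -> : (y.2 == ~~ x.2) = ~~ (x.2 == y.2) by case: (x.2); case: (y.2).
by congr (_ * _ * _); case: b; case: (x.2 == y.2).
Qed.

Lemma weight_close b (x y : ostrand n) gv gh gv' gh' (d : int) :
  `|gv - gv'| <= d -> `|gh - gh'| <= d ->
  `|weight b x y gv gh - weight b x y gv' gh'| <= d.
Proof.
move=> hv hh; rewrite /weight -mulrBr !normrM.
have d0 : 0 <= d by apply: le_trans hv; rewrite normr_ge0.
have t1 : `|T x.1 y.1| <= 1.
  by have := T1 x.1 y.1; rewrite !inE => /or3P[]/eqP->; rewrite ?normrN ?normr0 ?normr1.
have -> : `|(if b then 1 else -1 : int)| = 1 by case: b; rewrite ?normrN normr1.
have -> : `|(if x.2 == y.2 then 1 else -1 : int)| = 1 by case: ifP; rewrite ?normrN normr1.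
rewrite !mulr1 -[d]mul1r; apply: ler_pM => //.
by case: ifP => _; case: ifP => _; rewrite ?subrr ?normr0 //; case: ifP.
Qed.

(** A Lipschitz condition with respect to the number of crossing changes, for words with [k] strands
    below and [m0] above. *)
Definition adapted (g : uword -> int) (k m0 : nat) :=
  forall (d : nat) m m', nearby d k m m' -> sz m k = Some m0 -> `|g m - g m'| <= d%:Z.

Lemma adapted0 g k m0 m m' : adapted g k m0 -> nearby 0 k m m' ->
  sz m k = Some m0 -> g m = g m'.
Proof.
by move=> h /h{h}h /h; rewrite normr_le0 subr_eq0 => /eqP.
Qed.

Lemma contrib_close g g' e s (d : int) :
  0 <= d ->
  (forall i b, e = Cross i b -> (i + 2 <= size s)%N -> `|g [::] - g' [::]| <= d /\
     `|g [:: Cap i; Cup i tt] - g' [:: Cap i; Cup i tt]| <= d) ->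
  `|contrib g e s - contrib g' e s| <= d.
Proof.
move=> d0; rewrite /contrib /crossing_in.
case: e => [i a|i|i b]; rewrite ?subrr ?normr0 // => /(_ i b erefl).
have := size_drop i s; case: drop => [|x [|y q]] /= hs; rewrite ?subrr ?normr0 //.
by case=> [|h1 h2]; [lia | apply: weight_close].
Qed.

Lemma contrib_eq g g' e s :
  (forall i b, e = Cross i b -> (i + 2 <= size s)%N -> g [::] = g' [::] /\
     g [:: Cap i; Cup i tt] = g' [:: Cap i; Cup i tt]) ->
  contrib g e s = contrib g' e s.
Proof.
move=> h; apply/eqP; rewrite -subr_eq0 -normr_le0; apply: contrib_close => // i b ee hs.
by have [-> ->] := h i b ee hs; rewrite !subrr normr0.
Qed.

Lemma csum_exchange g e f s s' :
  orun [:: e; shift (pos e + arity_out e) f] s = Some s' ->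
  adapted g (size s) (size s') ->
  csum g [:: e; shift (pos e + arity_out e) f] s =
  csum g [:: shift (pos e + arity_in e) f; e] s.
Proof.
move=> h; have [p [t [p' [t' [es sp hp ht es']]]]] := exchange_split (or_introl h).
have [sp' r1 r2] := exchange_run sp hp ht.
rewrite es es' => hg.
have le : (pos e + arity_in e <= size p)%N by rewrite sp.
rewrite /= -!sp' -!sp !(apply_event_cat _ _ le) hp /= !apply_event_shift ht /=.
rewrite !(contrib_cat _ _ _ _ le) !contrib_shift !addr0 addrC.
have sep : sz_event e (size p) = Some (size p') := size_apply_event hp.
have sft : sz_event f (size t) = Some (size t') := size_apply_event ht.
set E := map_event (fun=> tt) e; set F := map_event (fun=> tt) f.
have fE d : map_event (fun=> tt) (shift d f) = shift d F by rewrite map_event_shift.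
have hF : sz_event F (size t) = Some (size t') by rewrite -sft /F; case: (f).
have hE : sz_event E (size p) = Some (size p') by rewrite -sep /E; case: (e).
have pE : (pos E + arity_in E)%N = size p by rewrite sp /E; case: (e).
have pE' : (pos E + arity_out E)%N = size p' by rewrite sp' /E; case: (e).
have k0 : size (p ++ t) = (pos E + arity_in E + size t)%N by rewrite size_cat pE.
have m0 : size (p' ++ t') = (pos E + arity_out E + size t')%N by rewrite size_cat pE'.
rewrite !fE (apply_event_cat _ _ le) hp addr0.
rewrite -pE -pE' in k0 m0 *; rewrite k0 m0 in hg; congr (_ + _); apply: contrib_eq => i b ee hi /=.
  (* Here [f] is the crossing, and [e] slides past the cap and the cup of its horizontal
     smoothing. *)
  split=> //.
  have zc : sz [:: Cap i; Cup i tt] (size t) = Some (size t').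
    move: hF hi; rewrite /F ee; move: (size t) (size t') => a a'.
    rewrite {1}/sz_event /=; case: ifP => // hi [<-] _; sz_tac.
  have := nearby_slide E zc; rewrite /= => /(adapted0 hg); apply.
  have z : sz ([:: E] ++ map (shift (pos E + arity_out E)) [:: Cap i; Cup i tt])
      (pos E + arity_in E + size t) = Some (pos E + arity_out E + size t')%N.
    by rewrite sz_cat [sz [:: E] _]/= sz_event_in [obind _ _]sz_shiftE zc.
  exact: z.
(* Here [e] is the crossing, and [f] slides past the smoothing instead. *)
have {}pE : (pos E + arity_in E = i + 2)%N by rewrite /E ee.
have {}pE' : (pos E + arity_out E = i + 2)%N by rewrite /E ee.
rewrite pE pE' in hg *; split=> //.
apply: (adapted0 hg (nearby_smoothing_slide (i := i) erefl hF)).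
have z1 : sz [:: Cap i; Cup i tt] (i + 2 + size t) = Some (i + 2 + size t)%N by sz_tac.
have z2 := sz_shiftE [:: F] (i + 2) (size t).
have := sz_cat [:: Cap i; Cup i tt] (map (shift (i + 2)) [:: F]) (i + 2 + size t).
by rewrite z1 [obind _ _]z2 /= hF.
Qed.

End Local.

(** * Crossings inside the face of a move *)

Lemma nearby_capslide i b k : (i + 3 <= k)%N ->
  nearby 0 k [:: Cross i.+1 b; Cap i] [:: Cross i (~~ b); Cap i.+1].
Proof.
by move=> h; apply: (nearby_planar (m := (k - 2)%N) (m' := (k - 2)%N) (PlanarCapSlide _ i b));
  sz_tac.
Qed.

Lemma nearby_cupslide i b k : (i < k)%N ->
  nearby 0 k [:: Cup i tt; Cross i.+1 b] [:: Cup i.+1 tt; Cross i (~~ b)].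
Proof.
by move=> h; apply: (nearby_planar (m := k.+2) (m' := k.+2) (PlanarCupSlide i tt b));
  sz_tac.
Qed.

Lemma nearby_cancel i b b' k : b' = ~~ b -> (i + 2 <= k)%N ->
  nearby 0 k [:: Cross i b; Cross i b'] [::].
Proof. by move=> -> h; apply/nearby_sym/nearby_RII. Qed.

(* First, second and third refer to the order of the crossings on the left hand
   side of a RIII move.  When the third strand lies above or below both strands
   of the smoothed crossing, it slides across the smoothing. *)
Lemma smooth_first_horizontal i b k : (i + 3 <= k)%N ->
  nearby 0 k [:: Cap i; Cup i tt; Cross i.+1 b; Cross i b]
             [:: Cross i.+1 b; Cross i b; Cap i.+1; Cup i.+1 tt].
Proof.
move=> h.
have e1 : nearby 0 (k - 2) [:: Cup i tt; Cross i.+1 b] [:: Cup i.+1 tt; Cross i (~~ b)].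
  by apply: nearby_cupslide; lia.
have e2 : nearby 0 k [:: Cross i (~~ b); Cross i b] [::].
  by apply: nearby_cancel; rewrite ?negbK //; lia.
have e3 := nearby_capslide (~~ b) h; rewrite negbK in e3.
have e4 : nearby 0 k [:: Cross i.+1 b; Cross i.+1 (~~ b)] [::].
  by apply: nearby_cancel => //; lia.
apply: (@nearby_cat0 0 k (k - 2) k [:: Cap i] [:: Cross i b] _ _ e1); [sz_tac..|].
apply: (@nearby_cat0 0 k k k [:: Cap i; Cup i.+1 tt] [::] _ _ e2); [sz_tac..|].
apply: nearby_sym.
apply: (@nearby_cat0 0 k k k [:: Cross i.+1 b] [:: Cup i.+1 tt] _ _ (nearby_sym e3));
  [sz_tac..|].
apply: (@nearby_cat0 0 k k k [::] [:: Cap i; Cup i.+1 tt] _ _ e4); [sz_tac..|].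
by apply: (@nearby_refl _ _ _ k); sz_tac.
Qed.

Lemma smooth_third_horizontal i b k : (i + 3 <= k)%N ->
  nearby 0 k [:: Cross i b; Cross i.+1 b; Cap i; Cup i tt]
             [:: Cap i.+1; Cup i.+1 tt; Cross i b; Cross i.+1 b].
Proof.
move=> h.
have e1 := nearby_capslide b h.
have e2 : nearby 0 k [:: Cross i b; Cross i (~~ b)] [::]
  by apply: nearby_cancel => //; lia.
have e3 : nearby 0 (k - 2) [:: Cup i tt; Cross i.+1 (~~ b)] [:: Cup i.+1 tt; Cross i b].
  by rewrite -{2}[b]negbK; apply: nearby_cupslide; lia.
have e4 : nearby 0 k [:: Cross i.+1 (~~ b); Cross i.+1 b] [::].
  by apply: nearby_cancel; rewrite ?negbK //; lia.
apply: (@nearby_cat0 0 k k k [:: Cross i b] [:: Cup i tt] _ _ e1); [sz_tac..|].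
apply: (@nearby_cat0 0 k k k [::] [:: Cap i.+1; Cup i tt] _ _ e2); [sz_tac..|].
apply: nearby_sym.
apply: (@nearby_cat0 0 k (k - 2) k [:: Cap i.+1] [:: Cross i.+1 b] _ _ (nearby_sym e3));
  [sz_tac..|].
apply: (@nearby_cat0 0 k k k [:: Cap i.+1; Cup i tt] [::] _ _ e4); [sz_tac..|].
by apply: (@nearby_refl _ _ _ k); sz_tac.
Qed.

Lemma smooth_second_horizontal i b k : (i + 3 <= k)%N ->
  nearby 0 k [:: Cross i b; Cap i.+1; Cup i.+1 tt; Cross i (~~ b)]
             [:: Cross i.+1 (~~ b); Cap i; Cup i tt; Cross i.+1 b].
Proof.
move=> h.
have e1 := nearby_sym (nearby_capslide (~~ b) h); rewrite negbK in e1.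
have e2 := @nearby_cupslide i b (k - 2) ltac:(lia).
apply: (@nearby_cat0 0 k k k [::] [:: Cup i.+1 tt; Cross i (~~ b)] _ _ e1); [sz_tac..|].
apply: (@nearby_cat0 0 k (k - 2) k [:: Cross i.+1 (~~ b); Cap i] [::] _ _ (nearby_sym e2));
  [sz_tac..|].
by apply: (@nearby_refl _ _ _ k); sz_tac.
Qed.

Lemma nearby_flip_ctx d k k' m i b u v w :
  nearby d k (u ++ [:: Cross i (~~ b)] ++ v) w ->
  sz u k = Some k' -> (i + 2 <= k')%N -> sz (u ++ [:: Cross i b] ++ v) k = Some m ->
  nearby d.+1 k (u ++ [:: Cross i b] ++ v) w.
Proof.
move=> h hu hi hm; rewrite -add1n; apply: nearby_trans h.
exact: nearby_ctx hu (nearby_flip _ hi) hm.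
Qed.

(** One crossing is changed on each side, after which the remaining strand can slide freely; this is
    the origin of the constant 2. *)
Lemma nearby_two_flips k k1 k2 i1 i2 u1 v1 u2 v2 b :
  nearby 0 k (u1 ++ [:: Cross i1 (~~ b)] ++ v1) (u2 ++ [:: Cross i2 (~~ b)] ++ v2) ->
  sz u1 k = Some k1 -> (i1 + 2 <= k1)%N -> sz (u1 ++ [:: Cross i1 b] ++ v1) k = Some k ->
  sz u2 k = Some k2 -> (i2 + 2 <= k2)%N -> sz (u2 ++ [:: Cross i2 b] ++ v2) k = Some k ->
  nearby 2 k (u1 ++ [:: Cross i1 b] ++ v1) (u2 ++ [:: Cross i2 b] ++ v2).
Proof.
move=> h hu1 h1 z1 hu2 h2 z2.
apply: nearby_flip_ctx hu1 h1 z1; apply: nearby_sym.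
by apply: nearby_flip_ctx hu2 h2 z2; apply: nearby_sym.
Qed.

(** The strand not involved in the smoothed crossing meets the other two in the crossings [b2] and
    [b3]. It passes above both or below both exactly when these agree. *)
Lemma smooth_first i b2 b3 k : (i + 3 <= k)%N ->
  nearby (if b2 == b3 then 0 else 2) k [:: Cross i.+1 b2; Cross i b3]
                                       [:: Cross i.+1 b3; Cross i b2] /\
  nearby (if b2 == b3 then 0 else 2) k [:: Cap i; Cup i tt; Cross i.+1 b2; Cross i b3]
             [:: Cross i.+1 b3; Cross i b2; Cap i.+1; Cup i.+1 tt].
Proof.
move=> h; case: eqP => [->|].
  by split; [apply: (@nearby_refl _ _ _ k); sz_tac|apply: smooth_first_horizontal].
move=> e; have {e}-> : b3 = ~~ b2 by move: b2 b3 e => [] [].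
split.
  apply: (@nearby_two_flips k k k i.+1 i [::] [:: Cross i (~~ b2)] [:: Cross i.+1 (~~ b2)] [::]);
    [|sz_tac|lia|sz_tac|sz_tac|lia|sz_tac].
  by apply: (@nearby_refl _ _ _ k); sz_tac.
apply: (@nearby_two_flips k k k i.+1 i [:: Cap i; Cup i tt] [:: Cross i (~~ b2)]
   [:: Cross i.+1 (~~ b2)] [:: Cap i.+1; Cup i.+1 tt]);
    [|sz_tac|lia|sz_tac|sz_tac|lia|sz_tac].
exact: smooth_first_horizontal.
Qed.

Lemma smooth_third i b1 b2 k : (i + 3 <= k)%N ->
  nearby (if b1 == b2 then 0 else 2) k [:: Cross i b1; Cross i.+1 b2]
                                       [:: Cross i b2; Cross i.+1 b1] /\
  nearby (if b1 == b2 then 0 else 2) k [:: Cross i b1; Cross i.+1 b2; Cap i; Cup i tt]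
             [:: Cap i.+1; Cup i.+1 tt; Cross i b2; Cross i.+1 b1].
Proof.
move=> h; case: eqP => [->|].
  by split; [apply: (@nearby_refl _ _ _ k); sz_tac|apply: smooth_third_horizontal].
move=> e; have {e}-> : b1 = ~~ b2 by move: b2 b1 e => [] [].
split.
  apply: (@nearby_two_flips k k k i.+1 i [:: Cross i (~~ b2)] [::] [::] [:: Cross i.+1 (~~ b2)]);
    [|sz_tac|lia|sz_tac|sz_tac|lia|sz_tac].
  by apply: (@nearby_refl _ _ _ k); sz_tac.
apply: (@nearby_two_flips k k k i.+1 i [:: Cross i (~~ b2)] [:: Cap i; Cup i tt]
   [:: Cap i.+1; Cup i.+1 tt] [:: Cross i.+1 (~~ b2)]);
    [|sz_tac|lia|sz_tac|sz_tac|lia|sz_tac].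
exact: smooth_third_horizontal.
Qed.

(** The test is reversed here: the remaining strand starts in the middle, entering one crossing from
    the right and the other from the left, so it lies on one side of both strands exactly when [b1]
    and [b3] differ. *)
Lemma smooth_second i b1 b3 k : (i + 3 <= k)%N ->
  nearby (if b1 == b3 then 2 else 0) k [:: Cross i b1; Cross i b3]
                                       [:: Cross i.+1 b3; Cross i.+1 b1] /\
  nearby (if b1 == b3 then 2 else 0) k [:: Cross i b1; Cap i.+1; Cup i.+1 tt; Cross i b3]
             [:: Cross i.+1 b3; Cap i; Cup i tt; Cross i.+1 b1].
Proof.
move=> h.
have V b : nearby 0 k [:: Cross i b; Cross i (~~ b)] [:: Cross i.+1 (~~ b); Cross i.+1 b].
  apply: (nearby_trans (a := 0) (b := 0) (w2 := [::])).
    by apply: nearby_cancel => //; lia.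
  by apply/nearby_sym/nearby_cancel; rewrite ?negbK //; lia.
case: eqP => [->|e].
  split.
    by apply: (@nearby_two_flips k k k i i.+1 [:: Cross i b3] [::] [::] [:: Cross i.+1 b3]);
    [exact: V|sz_tac|lia|sz_tac|sz_tac|lia|sz_tac].
  apply: (@nearby_two_flips k k k i i.+1 [:: Cross i b3; Cap i.+1; Cup i.+1 tt] [::] [::]
     [:: Cap i; Cup i tt; Cross i.+1 b3]);
    [|sz_tac|lia|sz_tac|sz_tac|lia|sz_tac].
  exact: smooth_second_horizontal.
have {e}-> : b3 = ~~ b1 by move: b3 b1 e => [] [].
by split; [|apply: smooth_second_horizontal].
Qed.

(** * Contributions of the crossings of each move *)

Section Rules.
Variables (n : nat) (S T : 'M[int]_n).
Hypotheses (Ssym : S^T = S) (Tsym : T^T = T).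
Hypothesis T1 : forall i j, T i j \in [:: -1; 0; 1].
Implicit Types (e : event (ostrand n)) (s p q t : seq (ostrand n)) (w : oword n).
Notation orun := (run (@oopp n)).
Notation ostep := (apply_event (@oopp n)).
Notation weight := (weight S T).
Notation csum := (csum S T).

Lemma weight0 b x y : weight b x y 0 0 = 0.
Proof. by rewrite /weight; do 2 case: ifP => _; rewrite ?if_same mulr0. Qed.

Lemma split_strands i j s : (i + j <= size s)%N ->
  exists p t, [/\ s = p ++ t, size p = i & (j <= size t)%N].
Proof.
move=> h; have [|p [t [es sp]]] := @split_size _ s i; first by lia.
by exists p, t; split=> //; move: h; rewrite es size_cat sp leq_add2l.
Qed.

Lemma csum_at g i (w w0 : oword n) p t : size p = i -> w = map (shift i) w0 ->
  csum g w (p ++ t) = csum (fun m => g (map (shift i) m)) w0 t.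
Proof. by move=> <- ->; apply: csum_shift. Qed.

Ltac csum_simpl :=
  rewrite /= ?drop0 ?take0 /= /contrib /crossing_in /= ?drop0 /= ?addr0 ?add0r
    ?addn0 ?addn1.

Lemma nearby_zigzagL i k : (i + 1 <= k)%N -> nearby 0 k [:: Cup i.+1 tt; Cap i] [::].
Proof.
by move=> h; apply: (nearby_planar (m := k) (m' := k) (PlanarZigzagL i tt)); sz_tac.
Qed.

Lemma nearby_zigzagR i k : (i + 1 <= k)%N -> nearby 0 k [:: Cup i tt; Cap i.+1] [::].
Proof.
by move=> h; apply: (nearby_planar (m := k) (m' := k) (PlanarZigzagR i tt)); sz_tac.
Qed.

Lemma csum_cupslide g i a b s : (i + 1 <= size s)%N -> adapted g (size s) (size s).+2 ->
  csum g [:: Cup i a; Cross i.+1 b] s = csum g [:: Cup i.+1 a; Cross i (~~ b)] s.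
Proof.
move=> hi hg; have [p [[|x t] [es sp // _]]] := split_strands hi.
move: (size s) hg hi => k hg hi; rewrite es.
rewrite (@csum_at _ i _ [:: Cup 0 a; Cross 1 b] _ _ sp); last by rewrite /= addn0 addn1.
rewrite (@csum_at _ i _ [:: Cup 1 a; Cross 0 (~~ b)] _ _ sp);
  last by rewrite /= addn0 addn1.
csum_simpl; rewrite -(weight_reverse Ssym Tsym) oppK_ostrand.
congr weight; apply: (adapted0 hg); try sz_tac.
  apply: (@nearby_cat0 0 k k k.+2 [::] [:: Cup i.+1 tt] _ _ (nearby_zigzagR hi));
    [sz_tac..|].
  by apply: (@nearby_refl _ _ _ k.+2); sz_tac.
apply: nearby_sym; apply: (@nearby_cat0 0 k k k.+2 [::] [:: Cup i tt] _ _ (nearby_zigzagL hi));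
  [sz_tac..|].
by apply: (@nearby_refl _ _ _ k.+2); sz_tac.
Qed.

Lemma csum_capslide g i b s s' : orun [:: Cross i.+1 b; Cap i] s = Some s' ->
  (i + 3 <= size s)%N -> adapted g (size s) (size s - 2) ->
  csum g [:: Cross i.+1 b; Cap i] s = csum g [:: Cross i (~~ b); Cap i.+1] s.
Proof.
move=> hs hi hg; have [p [[|x [|y [|z t]]] [es sp // _]]] := split_strands hi.
(* After the crossing the maximum joins [x] and [z], so they are one strand read in opposite
   directions. This is what [weight_reverse] requires. *)
have ez : z = oopp x.
  move: hs; rewrite es (_ : [:: _; _] = map (shift (size p)) [:: Cross 1 b; Cap 0]);
    last first.
    by rewrite /= sp addn0 addn1.
  by rewrite run_shift /=; case: eqP.
move: (size s) hg hi => k hg hi; rewrite es ez.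
rewrite (@csum_at _ i _ [:: Cross 1 b; Cap 0] _ _ sp); last by rewrite /= addn0 addn1.
rewrite (@csum_at _ i _ [:: Cross 0 (~~ b); Cap 1] _ _ sp);
  last by rewrite /= addn0 addn1.
csum_simpl; rewrite eqxx !addr0 -(weight_reverse Ssym Tsym (~~ b)) negbK.
congr weight; apply: (adapted0 hg); try sz_tac.
  apply: nearby_sym.
  apply: (@nearby_cat0 0 k (k - 2) (k - 2) [:: Cap i] [::] _ _ (nearby_zigzagR (i := i) _));
    [lia|sz_tac..|].
  by apply: (@nearby_refl _ _ _ (k - 2)); sz_tac.
apply: (@nearby_cat0 0 k (k - 2) (k - 2) [:: Cap i.+1] [::] _ _ (nearby_zigzagL (i := i) _));
  [lia|sz_tac..|].
by apply: (@nearby_refl _ _ _ (k - 2)); sz_tac.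
Qed.

Lemma csum_no_crossing g (w : oword n) s :
  all (fun e => if e is Cross _ _ then false else true) w -> csum g w s = 0.
Proof.
elim: w g s => //= e w IH g s /andP[he hw].
have c0 g' : contrib S T g' e s = 0 by case: e he.
by rewrite c0 add0r; case: apply_event => // t; rewrite IH.
Qed.

(** The vertical smoothing of the kink splits off a circle and the horizontal one becomes two
    zigzags. Both deviations vanish, whichever smoothing the entry of [S] selects. *)
Lemma csum_RI g (l r : oword n) s : RI l r -> orun r s = Some s ->
  adapted g (size s) (size s) -> g [::] = 0 ->
  (forall i, (i <= size s)%N -> g (circle i) = 0) -> csum g r s = 0.
Proof.
case=> i a b hs hg g0 gc.
  have hi : (i + 1 <= size s)%N.
    by move: hs => /=; case: ltnP => // h _; rewrite addn1.
  have [p [[|x t] [es sp // _]]] := split_strands hi.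
  move: (size s) hg gc hi => k hg gc hi; rewrite es.
  rewrite (@csum_at _ i _ [:: Cup 1 a; Cross 0 b; Cap 1] _ _ sp);
    last by rewrite /= addn0 addn1.
  csum_simpl.
  rewrite gc; last by rewrite -addn1.
  rewrite (_ : g _ = 0) ?weight0; last first.
    rewrite -g0; apply: (adapted0 hg); last by sz_tac.
    apply: (@nearby_cat0 0 k k k [::] [:: Cup i tt; Cap i.+1] _ _ (nearby_zigzagL hi));
      [sz_tac..|].
    exact: nearby_zigzagR.
  by rewrite add0r; case: ifP.
have hi : (i + 1 <= size s)%N.
  have := size_run hs; rewrite /= /sz_event /=.
  by case: ifP => //= h1; case: ifP => //= h2 _; lia.
have [p [[|x t] [es sp // _]]] := split_strands hi.
move: (size s) hg gc hi => k hg gc hi; rewrite es.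
rewrite (@csum_at _ i _ [:: Cup 0 a; Cross 1 b; Cap 0] _ _ sp);
  last by rewrite /= addn0 addn1.
csum_simpl.
rewrite gc; last by lia.
rewrite (_ : g _ = 0) ?weight0; last first.
  rewrite -g0; apply: (adapted0 hg); last by sz_tac.
  apply: (@nearby_cat0 0 k k k [::] [:: Cup i.+1 tt; Cap i] _ _ (nearby_zigzagR hi));
    [sz_tac..|].
  exact: nearby_zigzagL.
by rewrite add0r; case: ifP.
Qed.

Lemma csum_RII g i b s : (i + 2 <= size s)%N -> adapted g (size s) (size s) ->
  `|csum g [:: Cross i b; Cross i (~~ b)] s| <= 1.
Proof.
move=> hi hg; have [p [[|x [|y t]] [es sp // _]]] := split_strands hi.
move: (size s) hg hi => k hg hi; rewrite es.
rewrite (@csum_at _ i _ [:: Cross 0 b; Cross 0 (~~ b)] _ _ sp);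
  last by rewrite /= addn0.
(* The opposite signs turn the sum into a difference of weights with the same coefficients, so only
   the distance between corresponding smoothings counts. *)
csum_simpl; rewrite (weight_swap Ssym Tsym).
have kink c : nearby 0 k [:: Cap i; Cup i tt; Cross i c] [:: Cap i; Cup i tt].
  by apply: (nearby_catl (u := [:: Cap i]) (k' := (k - 2)%N));
    [sz_tac | apply: cup_kink; lia].
have kink' c : nearby 0 k [:: Cross i c; Cap i; Cup i tt] [:: Cap i; Cup i tt].
  by apply: (nearby_catr (l := [:: Cross i c; Cap i]) (r := [:: Cap i]) (v := [:: Cup i tt]) (m := k));
    [apply: cap_kink; lia | sz_tac].
apply: (weight_close S T1).
  apply: (hg 1%N); last by sz_tac.
  by apply: nearby_sym; apply: nearby_flip; lia.
apply: (hg 1%N); last by sz_tac.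
apply: (nearby_trans (a := 1) (b := 0) (w2 := [:: Cap i; Cup i tt])); last first.
  exact/nearby_sym/kink'.
(* The horizontal smoothings agree up to free moves; the bound 0 is relaxed to the bound 1 required
   by the vertical ones. *)
by case: (kink (~~ b)) => m [h1 h2 h3]; exists m; split=> // u v hu hv; case: (h3 u v hu hv) => [[]] // _ ?; exists 0%N.
Qed.

Lemma csum_RIII g i b1 b2 b3 s : (b2 == b1) || (b2 == b3) ->
  (i + 3 <= size s)%N -> adapted g (size s) (size s) ->
  `|csum g [:: Cross i b1; Cross i.+1 b2; Cross i b3] s -
    csum g [:: Cross i.+1 b3; Cross i b2; Cross i.+1 b1] s| <= 2.
Proof.
move=> hb hi hg; have [p [[|x [|y [|z t]]] [es sp // _]]] := split_strands hi.
move: (size s) hg hi => k hg hi; rewrite es.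
rewrite (@csum_at _ i _ [:: Cross 0 b1; Cross 1 b2; Cross 0 b3] _ _ sp);
  last by rewrite /= addn0 addn1.
rewrite (@csum_at _ i _ [:: Cross 1 b3; Cross 0 b2; Cross 1 b1] _ _ sp);
  last by rewrite /= addn0 addn1.
csum_simpl.
have [v1 h1] := smooth_first b2 b3 hi.
have [v2 h2] := smooth_second b1 b3 hi.
have [v3 h3] := smooth_third b1 b2 hi.
have C d m1 m2 m3 m4 b u v : nearby d k m1 m3 -> nearby d k m2 m4 ->
    sz m1 k = Some k -> sz m2 k = Some k ->
    `|weight b u v (g m1) (g m2) - weight b u v (g m3) (g m4)| <= d%:Z.
  by move=> *; apply: (weight_close S T1); apply: hg.
set A1 := weight b1 _ _ _ _; set A2 := weight b2 _ _ _ _; set A3 := weight b3 _ _ _ _.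
set B3 := weight b3 _ _ _ _; set B2 := weight b2 _ _ _ _; set B1 := weight b1 _ _ _ _.
have c1 : `|A1 - B1| <= (if b2 == b3 then 0 else 2)%N by apply: C => //; sz_tac.
have c2 : `|A2 - B2| <= (if b1 == b3 then 2 else 0)%N by apply: C => //; sz_tac.
have c3 : `|A3 - B3| <= (if b1 == b2 then 0 else 2)%N by apply: C => //; sz_tac.
(* Under [hb] exactly one of the three bounds is 2, namely at the crossing of the top and bottom
   strands. The excluded cyclic pattern would make all three equal to 2. *)
move: hb c1 c2 c3; move: A1 A2 A3 B1 B2 B3 => A1 A2 A3 B1 B2 B3.
by clear; case: b1; case: b2; case: b3 => //= _; lia.
Qed.

End Rules.

(** * Moves inside a whole diagram *)

Lemma local_move_map A B (f : A -> B) c (l r : word A) : local_move c l r ->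
  local_move c (map (map_event f) l) (map (map_event f) r).
Proof.
case=> [e e'|i {}c {}l {}r h].
  rewrite /= !map_event_shift -(map_event_pos f) -(map_event_in f) -(map_event_out f).
  exact: LocalExchange.
by rewrite !map_map_shift; apply: LocalCore; case: h => *; constructor.
Qed.

Lemma forget_cat n (u v : oword n) : forget (u ++ v) = forget u ++ forget v.
Proof. exact: map_cat. Qed.

Lemma sz_forget n (w : oword n) k : sz (forget w) k = sz w k.
Proof. exact: sz_map. Qed.

Section Moves.
Variables (n : nat) (S T : 'M[int]_n).
Hypotheses (Ssym : S^T = S) (Tsym : T^T = T).
Hypothesis T1 : forall i j, T i j \in [:: -1; 0; 1].
Implicit Types (u v l r : oword n) (s : seq (ostrand n)).
Notation orun := (run (@oopp n)).
Notation csum := (csum S T).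

Definition context u v l (m : uword) : int :=
  deviation (u ++ l ++ v) (forget u ++ m ++ forget v).

Lemma near_dist d w w' (c : nat) : near d w w' ->
  `| `|(link_u w)%:Z - c%:Z| - `|(link_u w')%:Z - c%:Z| | <= d%:Z.
Proof. by move=> /link_u_near; lia. Qed.

(** Reduction to the face: the terms from [u] and [v] cancel, and the rest is measured by one common
    function, since the reference value of the link is the same for both diagrams. *)
Lemma iu_replace u v l r : local_move false l r ->
  is_diagram (@oopp n) (u ++ l ++ v) -> is_diagram (@oopp n) (u ++ r ++ v) ->
  exists s s', [/\ orun l s = Some s', orun r s = Some s',
    adapted (context u v l) (size s) (size s'),
    forall i, l = [::] -> (i <= size s)%N -> context u v l (circle i) = 0 &
    iu S T (u ++ l ++ v) - iu S T (u ++ r ++ v) =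
    csum (context u v l) l s - csum (context u v l) r s].
Proof.
move=> hlr hD hE.
have [s [s' [hu hl hv]]] := diagram_cat hD.
have [s1 [s1' [hu1 hr hv1]]] := diagram_cat hE.
move: hu1 hr; rewrite hu => -[<-] hr {s1}.
have es := local_move_run (@oppK_ostrand n) hlr hl hr; rewrite -es in hr hv1.
have zu : sz (forget u) 0 = Some (size s) by rewrite sz_forget (size_run hu).
have zl : sz (forget l) (size s) = Some (size s') by rewrite sz_forget (size_run hl).
have zr : sz (forget r) (size s) = Some (size s') by rewrite sz_forget (size_run hr).
have zv : sz (forget v) (size s') = Some 0%N by rewrite sz_forget (size_run hv).
have nlr x y : sz x 0 = Some (size s) -> sz y (size s') = Some 0%N ->
   near 0 (x ++ forget l ++ y) (x ++ forget r ++ y).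
  move=> hx hy; apply: (@near_local false); first exact: local_move_map.
    by rewrite sz_cat hx /= sz_cat zl.
  by rewrite sz_cat hx /= sz_cat zr.
have edev m : deviation (u ++ r ++ v) m = deviation (u ++ l ++ v) m.
  by rewrite /deviation !forget_cat (link_u_near0 (nlr _ _ zu zv)).
exists s, s'; split=> //.
- move=> d m m' [k [hm hm' h]]; rewrite hm => -[ek]; rewrite ek in h.
  by rewrite /context /deviation; apply: near_dist; apply: h.
- move=> i el hi; rewrite /context /deviation.
  rewrite (link_u_circle zu _ hi); last by move: zl zv; rewrite el /= => -[->].
  by rewrite el /= forget_cat subrr normr0.
rewrite !iu_csum //.
rewrite !(csum_cat _ _ _ _ hu) !(csum_cat _ _ _ _ hl) !(csum_cat _ _ _ _ hr).
rewrite opprD addrACA; set X := (X in X + _ = _).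
(* Smoothing a crossing below the move leaves its place intact, so the same free move still relates
   the smoothed diagrams. The crossings above are treated likewise. *)
have -> : X = 0.
  apply/eqP; rewrite /X subr_eq0; apply/eqP.
  apply: (csum_ext _ _ hu (size_run hu)) => m hm /=.
  by rewrite edev /deviation !forget_cat (link_u_near0 (nlr m _ hm zv)).
rewrite add0r opprD addrACA; set Y := (X in _ + X = _).
have -> : Y = 0.
  apply/eqP; rewrite /Y subr_eq0; apply/eqP.
  apply: (csum_ext _ _ hv (size_run hv)) => m hm /=.
  by rewrite edev /deviation (link_u_near0 (nlr _ m zu hm)).
rewrite addr0 /context; congr (_ - _).
by congr csum; apply: funext => m; rewrite edev.
Qed.

Lemma context0 u v l : context u v l (forget l) = 0.
Proof. by rewrite /context /deviation !forget_cat subrr normr0. Qed.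

Lemma iu_planar D E : replace (@oopp n) (@planar_local (ostrand n)) D E ->
  iu S T D = iu S T E.
Proof.
case=> u v l r h hD hE; apply/eqP; rewrite -subr_eq0; apply/eqP.
have hlr : local_move false l r by apply/local_moveP; left.
have [s [s' [hl hr hg _ ->]]] := iu_replace hlr hD hE.
apply/eqP; rewrite subr_eq0; apply/eqP.
have zl := size_run hl; have zr := size_run hr.
case: l r / h hg hl hr zl zr {hlr hD hE} => [e f|i a|i a|i a b|i b] hg hl hr zl zr.
- exact: csum_exchange hl hg.
- by rewrite !csum_no_crossing.
- by rewrite !csum_no_crossing.
- move: zl; rewrite /= /sz_event /=; case: ifP => //= h1; case: ifP => //= h2 [ek].
  have hi : (i + 1 <= size s)%N.
    by move: zr; rewrite /= /sz_event /=; case: ifP => //= h3 _; lia.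
  have e : size s' = (size s).+2 by rewrite -ek; move: hi {hg}; clear; move: (size s) => k; lia.
  by rewrite e in hg; apply: csum_cupslide.
- move: (zl); rewrite /= /sz_event /=; case: ifP => //= h1; case: ifP => //= h2 [ek].
  have e : size s' = (size s - 2)%N by rewrite -ek; move: h1; clear; move: (size s) => k; lia.
  have hi : (i + 3 <= size s)%N by move: h1; clear; move: (size s) => k; lia.
  by rewrite e in hg; apply: (csum_capslide Ssym Tsym hl).
Qed.

(** The swung arc has no crossings, and smoothing a crossing of [u] or [v] commutes with the swing,
    so terms correspond one to one. *)
Lemma iu_infinity D E : through_infinity (@oopp n) D E -> iu S T D = iu S T E.
Proof.
case=> u v a s hu hD hE; rewrite !iu_csum //.
have hv : orun v (oopp a :: s) = Some [::] by move: hD; rewrite /is_diagram run_cat hu.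
have zu : sz u 0 = Some (size s).+1 := size_run hu.
have zv : sz v (size s).+1 = Some 0%N := size_run hv.
have esw (x y : oword n) : forget (swing a x y) = swing tt (forget x) (forget y).
  by rewrite /swing /forget /= !map_cat /= !map_cat /= !map_map_shift.
have edev x y : sz x 0 = Some (size s).+1 -> sz y (size s).+1 = Some 0%N ->
    deviation (u ++ v) (x ++ y) = deviation (swing a u v) (swing tt x y).
  move=> hx hy; rewrite /deviation esw forget_cat (link_u_near0 (near_infinity hx hy)).
  by rewrite (link_u_near0 (near_infinity (u := forget u) (v := forget v) (k := size s) _ _)) ?sz_forget.
rewrite (csum_cat _ _ _ _ hu).
have r1 : orun [:: Cup 0 a] [::] = Some [:: a; oopp a] by [].
have r2 : orun (map (shift 1) u) [:: a; oopp a] = Some (a :: oopp a :: rcons s (oopp a)).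
  have := run_frame (@oopp n) [:: a] [:: oopp a] (s := [::]) zu.
  by rewrite hu /= -cats1.
have r3 : orun [:: Cap 0; Cup 0 a] (a :: oopp a :: rcons s (oopp a)) =
    Some (a :: oopp a :: rcons s (oopp a)).
  by rewrite /= eqxx /= take0 drop0.
have r4 : orun (map (shift 1) v) (a :: oopp a :: rcons s (oopp a)) = Some [:: a; oopp a].
  have := run_frame (@oopp n) [:: a] [:: oopp a] (s := oopp a :: s) zv.
  by rewrite hv /= -cats1.
rewrite -[swing a u v]/([:: Cup 0 a] ++ map (shift 1) u ++ [:: Cap 0; Cup 0 a]
    ++ map (shift 1) v ++ [:: Cap 0]).
rewrite (csum_cat _ _ _ _ r1) (csum_cat _ _ _ _ r2) (csum_cat _ _ _ _ r3) (csum_cat _ _ _ _ r4).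
rewrite [X in _ = X + _]csum_no_crossing // add0r.
rewrite [X in _ = _ + (X + _)]csum_no_crossing // add0r.
rewrite [X in _ = _ + (_ + X)]csum_no_crossing // addr0.
congr (_ + _).
  rewrite -[[:: a; oopp a]]/([:: a] ++ [::] ++ [:: oopp a]).
  rewrite (csum_shift _ _ _ [:: a]) (csum_state_cat _ _ _ _ (s := [::]) zu).
  apply: (csum_ext _ _ hu zu) => m hm.
  rewrite edev ?sz_forget //; congr deviation.
  by rewrite /swing /forget /= !map_cat /= map_map_shift.
rewrite -[a :: _]/([:: a] ++ _) -rcons_cons -cats1.
rewrite (csum_shift _ _ _ [:: a]) (csum_state_cat _ _ _ _ (s := oopp a :: s) zv).
apply: (csum_ext _ _ hv zv) => m hm.
rewrite edev ?sz_forget //; congr deviation.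
by rewrite /swing /forget /= map_map_shift.
Qed.

Lemma iu_isotopic D E : isotopic (@oopp n) D E -> iu S T D = iu S T E.
Proof.
elim=> [x y [h|h]|//|x y _ ->|x y z _ -> _ ->] //.
  exact: iu_planar.
exact: iu_infinity.
Qed.

Lemma iu_RI D E : replace (@oopp n) RI D E -> iu S T E = iu S T D.
Proof.
case=> u v l r h hD hE; apply/eqP; rewrite eq_sym -subr_eq0; apply/eqP.
have hlr : local_move false l r by apply/local_moveP; right; left.
have [s [s' [hl hr hg gc ->]]] := iu_replace hlr hD hE.
have el : l = [::] by case: h.
have es : s = s' by move: hl; rewrite el => -[].
have g0 := context0 u v l; rewrite -es in hr hg.
rewrite (csum_RI _ _ h hr hg) //; last 2 first.
  by rewrite -g0 el.
  by move=> i; apply: gc.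
by rewrite subr0 el.
Qed.

Lemma iu_RII D E : replace (@oopp n) RII D E -> `|iu S T D - iu S T E| <= 1.
Proof.
case=> u v l r h hD hE.
have hlr : local_move false l r by apply/local_moveP; do 2 right; left.
have [s [s' [hl hr hg _ ->]]] := iu_replace hlr hD hE.
case: l r / h hg hl hr {hlr hD hE} => i b hg [es] hr.
rewrite -es in hr hg.
rewrite [csum _ [::] _]/= sub0r normrN; apply: csum_RII => //.
by have := size_run hr; rewrite /= /sz_event /=; case: ifP.
Qed.

Lemma iu_RIII D E : replace (@oopp n) RIII D E -> `|iu S T D - iu S T E| <= 2.
Proof.
case=> u v l r h hD hE.
have hlr : local_move false l r by apply/local_moveP; do 3 right.
have [s [s' [hl hr hg _ ->]]] := iu_replace hlr hD hE.
have zl := size_run hl.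
case: l r / h hg hl hr zl {hlr hD hE} => i b1 b2 b3 hb hg hl hr zl.
move: zl; rewrite /= /sz_event /=; case: ifP => //= h1; case: ifP => //= h2; case: ifP => //= _ [ek].
have e : size s' = size s by rewrite -ek; move: h1; clear; move: (size s) => k; lia.
have hi : (i + 3 <= size s)%N by move: h1 h2; clear; move: (size s) => k; lia.
by rewrite e in hg; apply: csum_RIII.
Qed.
End Moves.

Theorem theorem1p2 (n : nat) (hn : (1 <= n)%N)
    (L : set (oword n)) (hL : oriented_link L)
    (S T : 'M[int]_n)
    (hSsym : S^T = S) (hTsym : T^T = T)
    (hS : forall i j, S i j \in [:: -1; 0; 1])
    (hT : forall i j, T i j \in [:: -1; 0; 1])
    (hST : forall i j, T i j = 0 <-> S i j = 0)
    (D E : oword n) (hD : L D) (hE : L E) :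
  [/\ single_move (@oopp n) RI D E -> iu S T E = iu S T D,
      single_move (@oopp n) RII D E -> `|iu S T E - iu S T D| <= 1 &
      single_move (@oopp n) RIII D E -> `|iu S T E - iu S T D| <= 2].
Proof.
(* The two isotopies are absorbed by invariance; the move left over may go either way, which the
   symmetry of the distance handles. *)
split=> -[D' [E' [/(iu_isotopic hSsym hTsym hT)-> h /(iu_isotopic hSsym hTsym hT)<-]]].
- by case: h => /(iu_RI S T).
- by case: h => /(iu_RII hSsym hTsym hT); rewrite // distrC.
- by case: h => /(iu_RIII S hT); rewrite // distrC.
Qed.
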